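(* Let $F_2=\langle a,b\rangle$ and fix signs $\varepsilon,\delta\in\{1,-1\}$. Let $f\colon F_2\to F_2$ be the endomorphism with $f(a)=a^{\varepsilon}$ and $f(b)=b^{-1}a^{\delta}b$. For $N\ge1$ let $x$ be chosen uniformly at random among the $2^N$ positive words of length $N$ in $a,b$ (each letter is independently $a$ or $b$ with probability $1/2$). Then the probability that a cyclically reduced conjugate of $f(x)$ is polygonal converges to $1$ as $N\to\infty$. (In this sense simple height-one words, i.e. words $\prod_{i=1}^l a^{p_i}(b^{-1}a^{q_i}b)$ with $l>0$, all $p_i$ nonzero of the same sign and all $q_i$ nonzero of the same sign, are almost surely polygonal.)
   Context: Polygonality. Let $R$ be the bouquet of two oriented circles labeled $a,b$, so that $\pi_1(R)=F_2$. A graph is a 1-dimensional CW-complex; a graph map sends vertices to vertices and edges to edges; an immersion is a locally injective graph map. An immersion from a graph to $R$ induces an orientation and a label on each edge of the graph. A polygonal disk $P$ is a 2-disk whose boundary $\partial P$ has the CW-structure of a polygon. A side-pairing $\sim$ on polygonal disks $P_1,\dots,P_m$ is an equivalence relation on the set of all edges of $\coprod_i\partial P_i$ with every class of size exactly two, together with a choice of homeomorphism between the edges in each class. Then $S=\coprod_i P_i/\!\sim$ is a closed surface with a CW-structure having $m(S)=m$ two-cells. For a cyclically reduced word $w\in F_2$, $S$ is a closed $w$-polygonal surface if there is an immersion $\phi\colon S^{(1)}\to R$ such that for every $i$ the composition $\partial P_i\to S^{(1)}\to R$ is an immersion reading (from a suitable starting vertex and in a suitable direction) a non-zero power of $w$.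 The word $w$ is polygonal if there exists a closed $w$-polygonal surface $S$ with $\chi(S)<m(S)$. This property depends on $w$ only up to cyclic permutation. *)

(* Defs.v *)
From HB Require Import structures.
From mathcomp Require Import all_boot all_order all_algebra.
From mathcomp Require Import all_classical all_reals all_analysis.

Set Implicit Arguments.
Unset Strict Implicit.
Unset Printing Implicit Defensive.

(* The elements of the free group F_2 = <a, b> are the freely reduced words.  A letter is a pair
   (generator, exponent sign): the generator is [false] for a and [true] for b,
   and the sign is [true] for the inverse of the generator. *)

Definition letter : finType := (bool * bool)%type.

Definition linv (x : letter) : letter := (x.1, ~~ x.2).

Definition nocancel : rel letter := fun x y => y != linv x.

Definition reduced (w : seq letter) : bool := sorted nocancel w.

Lemma linvK : involutive linv.
Proof. by case=> c s; rewrite /linv /= negbK. Qed.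

Lemma nocancelC x y : nocancel (linv x) (linv y) = nocancel y x.
Proof. by rewrite /nocancel linvK (eq_sym x) (can2_eq linvK linvK). Qed.

Definition push (x : letter) (w : seq letter) : seq letter :=
  if w is y :: w' then (if y == linv x then w' else x :: w) else [:: x].

Lemma push_reduced x w : reduced w -> reduced (push x w).
Proof.
case: w => [|y w] //= rw; case: ifPn => [_|yx]; first exact: path_sorted rw.
by rewrite /reduced /= /nocancel yx.
Qed.

Lemma foldr_push_reduced u w : reduced w -> reduced (foldr push w u).
Proof. by move=> rw; elim: u => //= x u; apply: push_reduced. Qed.

Lemma pushK x w : reduced w -> push (linv x) (push x w) = w.
Proof.
case: w => [_|y w] /=; first by rewrite linvK eqxx.
case: ifPn => [/eqP ->|_]; last by rewrite /= linvK eqxx.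
case: w => [|z w] //= /andP[nz _].
by rewrite (negbTE nz).
Qed.

Lemma foldr_pushP x u w :
  reduced w -> foldr push w (push x u) = push x (foldr push w u).
Proof.
move=> rw; case: u => [|y u] //=; case: ifPn => [/eqP ->|_] //=.
have /(pushK (linv x)) : reduced (foldr push w u) by apply: foldr_push_reduced.
by rewrite linvK.
Qed.

Lemma foldr_push_nil u : reduced u -> foldr push [::] u = u.
Proof.
elim: u => //= x u IHu ru; rewrite IHu; last exact: path_sorted ru.
by case: u ru {IHu} => //= y u /andP[/negbTE ->].
Qed.

Definition winv (u : seq letter) : seq letter := rev (map linv u).

Lemma winvK : involutive winv.
Proof. by move=> u; rewrite /winv map_rev revK (mapK linvK). Qed.

Lemma winv_reduced u : reduced u -> reduced (winv u).
Proof.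
rewrite /winv /reduced rev_sorted sorted_map => ru.
by rewrite (@eq_sorted _ _ nocancel) // => x y; rewrite /= nocancelC.
Qed.

Lemma foldr_winv u w : reduced w -> foldr push (foldr push w u) (winv u) = w.
Proof.
move=> rw; elim: u => //= x u IHu.
rewrite /winv /= rev_cons -cats1 foldr_cat /= pushK ?foldr_push_reduced //.
Qed.

Record F2 : Type := MkF2 { word_of :> seq letter; word_ofP : reduced word_of }.
HB.instance Definition _ := [isSub for word_of].
HB.instance Definition _ := [Choice of F2 by <:].

Definition F2_one : F2 := @MkF2 [::] isT.
Definition F2_inv (u : F2) : F2 := MkF2 (winv_reduced (word_ofP u)).
Definition F2_mul (u v : F2) : F2 :=
  MkF2 (foldr_push_reduced u (word_ofP v)).

Lemma F2_mulA : associative F2_mul.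
Proof.
move=> u v w; apply: val_inj => /=; elim: (word_of u) => //= x s ->.
by rewrite foldr_pushP // word_ofP.
Qed.

Lemma F2_mul1 : left_id F2_one F2_mul.
Proof. by move=> u; apply: val_inj. Qed.

Lemma F2_mulr1 : right_id F2_one F2_mul.
Proof. by move=> u; apply: val_inj; rewrite /= foldr_push_nil ?word_ofP. Qed.

Lemma F2_mulV : left_inverse F2_one F2_inv F2_mul.
Proof.
move=> u; apply: val_inj => /=.
by rewrite -{1}[word_of u]foldr_push_nil ?word_ofP // foldr_winv.
Qed.

Lemma F2_mulrV : right_inverse F2_one F2_inv F2_mul.
Proof.
move=> u; have uVK : F2_inv (F2_inv u) = u by apply: val_inj; rewrite /= winvK.
by rewrite -{1}uVK F2_mulV.
Qed.

HB.instance Definition _ :=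
  isGroup.Build F2 F2_mulA F2_mul1 F2_mulr1 F2_mulV F2_mulrV.

Definition F2_letter (x : letter) : F2 := @MkF2 [:: x] isT.
Definition F2a : F2 := F2_letter (false, false).
Definition F2b : F2 := F2_letter (true, false).

Lemma F2_letter_inv (c s : bool) :
  F2_letter (c, s) =
  (let x := if c then F2b else F2a in if s then x^-1 else x)%g.
Proof. by apply: val_inj; case: c; case: s. Qed.

Lemma F2_universal (G : groupType) (x y : G) :
  exists f : {multiplicative F2 -> G}, f F2a = x /\ f F2b = y.
Proof.
pose ev (l : letter) : G :=
  (let z := if l.1 then y else x in if l.2 then z^-1 else z)%g.
have evV l : ev (linv l) = (ev l)^-1%g.
  by case: l => [] [] [] //=; rewrite /ev /= invgK.
pose f (u : F2) : G := (\prod_(l <- word_of u) ev l)%g.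
have evP l s : (\prod_(k <- push l s) ev k = ev l * \prod_(k <- s) ev k)%g.
  case: s => [|k s] /=; first by rewrite big_seq1 big_nil mulg1.
  case: ifP => [/eqP ->|_]; last by rewrite big_cons.
  by rewrite big_cons evV mulVKg.
have fM : {morph f : u v / (u * v)%g >-> (u * v)%g}.
  move=> u v; rewrite /f /=; elim: (word_of u) => [|l s IHs] /=.
    by rewrite big_nil mul1g.
  by rewrite evP IHs big_cons mulgA.
pose fm := HB.pack_for (Multiplicative.type F2 G) f
  (isMultiplicative.Build F2 G f fM).
by exists fm; split; rewrite /= /f /= big_seq1.
Qed.

Definition zexpg (G : groupType) (x : G) (k : int) : G :=
  match k with Posz n => (x ^+ n)%g | Negz n => (x ^- n.+1)%g end.

(* [cycle] also compares the last letter with the first one. *)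
Definition cyclically_reduced (w : F2) : bool := cycle nocancel (word_of w).

(* The sides of a family of polygons with [n i] sides: side [j] of polygon [i]
   is followed by side [j + 1 mod n i] along a fixed orientation of the
   boundary. *)
Definition side (I : finType) (n : I -> nat) : finType := {i : I & 'I_(n i)}.

Definition next_side (I : finType) (n : I -> nat) (s : side n) : side n :=
  Tagged (fun i => 'I_(n i)) (ordS (tagged s)).

(* A side-pairing.  The classes of size two are the orbits of a fixed-point-free
   involution [mate].  Of the chosen homeomorphism between two paired sides only
   its effect on end points matters for the cell structure of the quotient, and
   this is recorded by [flip]: it is [true] when the homeomorphism reverses the
   boundary orientations.  The quotient surface may be non-orientable and may be
   disconnected. *)
Record side_pairing : Type := SidePairing {
  polygon : finType;
  nsides : polygon -> nat;
  nsides_gt0 : forall i, 0 < nsides i;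
  mate : side nsides -> side nsides;
  mateK : involutive mate;
  mate_neq : forall s, mate s != s;
  flip : side nsides -> bool;
  flip_mate : forall s, flip (mate s) = flip s
}.

Section Surface.
Variable S : side_pairing.

Local Notation sides := (side (@nsides S)).

(* A directed side [(s, d)] is traversed backwards when [d] is [true]; two
   directed sides define the same directed edge of the 1-skeleton iff they are
   equal or exchanged by [dmate]. *)
Definition dside : finType := (sides * bool)%type.

Definition dmate (z : dside) : dside := (mate z.1, z.2 (+) flip z.1).

(* A vertex of a polygon is represented by the side that starts there. *)
Definition dstart (z : dside) : sides :=
  if z.2 then next_side z.1 else z.1.

Definition glued : rel sides :=
  fun u v => [exists z : dside, (u == dstart z) && (v == dstart (dmate z))].

Lemma dmateK : involutive dmate.
Proof. by case=> s d; rewrite /dmate /= mateK flip_mate -addbA addbb addbF. Qed.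

Lemma glued_sym : symmetric glued.
Proof.
move=> u v; apply/existsP/existsP => -[z /andP[uz vz]];
  by exists (dmate z); rewrite dmateK uz vz.
Qed.

Lemma glued_connect_sym : connect_sym glued.
Proof. exact: sym_connect_sym glued_sym. Qed.

Definition same_vertex : rel sides := connect glued.

Definition num_vertices : nat := n_comp glued predT.
Definition num_edges : nat := #|sides|./2.
Definition num_faces : nat := #|polygon S|.

Definition euler_char : int :=
  (num_vertices%:Z - num_edges%:Z + num_faces%:Z)%R.

(* The letter read along a directed side. *)
Definition dlabel (lab : sides -> letter) (z : dside) : letter :=
  if z.2 then linv (lab z.1) else lab z.1.

(* [lab] induces a graph map from the 1-skeleton of the surface to the
   bouquet R. *)
Definition is_graph_map (lab : sides -> letter) : Prop :=
  forall z : dside, dlabel lab (dmate z) = dlabel lab z.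

(* Local injectivity at the vertices of the 1-skeleton: two directed edges
   issuing from the same vertex with the same letter are equal. *)
Definition is_immersion (lab : sides -> letter) : Prop :=
  is_graph_map lab /\
  forall z z' : dside, same_vertex (dstart z) (dstart z') ->
    dlabel lab z = dlabel lab z' -> z' = z \/ z' = dmate z.

(* Local injectivity of the boundary map of each polygon.  It follows from
   [reads_powers] when the word is cyclically reduced. *)
Definition boundary_immersed (lab : sides -> letter) : Prop :=
  forall s : sides, nocancel (lab s) (lab (next_side s)).

(* The word read once around a polygon, from the initial vertex of [s]. *)
Definition boundary_word (lab : sides -> letter) (s : sides) : seq letter :=
  [seq lab t | t <- traject (@next_side _ _) s (nsides (tag s))].

(* Since reading in the opposite direction inverts the word, letting the
   exponent range over the non-zero integers covers both directions. *)
Definition reads_powers (w : F2) (lab : sides -> letter) : Prop :=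
  forall i : polygon S, exists2 s : sides, tag s = i &
    exists2 k : int, k <> 0%R & boundary_word lab s = word_of (zexpg w k).

Definition polygonal_surface (w : F2) : Prop :=
  exists lab : sides -> letter,
    [/\ is_immersion lab, boundary_immersed lab & reads_powers w lab].

End Surface.

(* Meant for cyclically reduced [w]. *)
Definition polygonal (w : F2) : Prop :=
  exists S : side_pairing,
    polygonal_surface S w /\ (euler_char S < (num_faces S)%:Z)%R.

(* The letter [false] is a and the letter [true] is b. *)
Definition positive_word (N : nat) (t : N.-tuple bool) : F2 :=
  (\prod_(c <- t) (if c then F2b else F2a))%g.

(* Cyclically reduced conjugates of an element are cyclic permutations of each
   other, so any of them may be used here. *)
Definition conjugate_polygonal (g : F2) : Prop :=
  exists w : F2,
    [/\ exists h : F2, w = (g ^ h)%g, cyclically_reduced w & polygonal w].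

(* Distinct tuples give distinct positive words, so counting tuples is counting
   the 2^N positive words of length N. *)
Definition prob_positive (R : realType) (N : nat) (E : F2 -> Prop) : R :=
  (#|[set t : N.-tuple bool | `[< E (positive_word t) >]]|%:R / 2 ^+ N)%R.

(* Main.v *)
Require Import Defs.
From mathcomp Require Import all_boot all_order all_algebra.
From mathcomp Require Import all_classical all_reals all_analysis.
From mathcomp Require Import zify ring lra.
Import numFieldNormedType.Exports.

Set Implicit Arguments.
Unset Strict Implicit.
Unset Printing Implicit Defensive.

(* Up to conjugation f(x) is the word w = prod_i A^(p_i) B^-1 A'^(q_i) B, where
   the p_i and q_i are the lengths of the runs of x and A, A' are a or a^-1; by
   symmetry suppose sum p_i >= sum q_i.  Glue two copies of every block as
   follows.  On a circle of length L = 2 sum q_i made of a-edges the q-blocks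
   are laid one after the other, in the cyclic order 1, 1, 2, 2, ..., and wind
   around once; so do the p-blocks, in the same order, after the first copies
   of d = sum p_i - sum q_i blocks with p_i = 2 have been set aside.  Each block
   that was set aside winds twice around an a-loop of its own.  Thus every
   a-edge is traversed twice.  The letters B^(+-1) are glued in the way forced
   at their p-ends and q-ends, and the boundary words of the resulting polygons
   are powers of w.  The graph is folded and some of its vertices have links of
   length at least 3, so w is polygonal as soon as d runs of length 2 are
   available.  For a random x the number of such runs exceeds d outside of an
   event of exponentially small probability, by a Chernoff bound on windows of
   four letters. *)

(** * Surfaces assembled from orbits *)

Section OrbitPolygons.
Variables (X : finType) (nxt : X -> X).
Hypothesis nxt_inj : injective nxt.

(** The polygons are the orbits of [nxt], each named by its canonical root, and the sides of a
    polygon are the elements of its orbit. Thus [side_val] and [val_side] identify the sides of all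
    polygons with [X]. *)
Definition orbit_polygon : finType := {x : X | froot nxt x == x}.
Definition orbit_size (i : orbit_polygon) : nat := fingraph.order nxt (val i).

Lemma orbit_size_gt0 i : 0 < orbit_size i.
Proof. exact: order_gt0. Qed.

Definition side_val (s : side orbit_size) : X := iter (tagged s) nxt (val (tag s)).

Lemma side_val_next s : side_val (next_side s) = nxt (side_val s).
Proof.
case: s => i t; rewrite /side_val /= -iterS.
have : t.+1 <= orbit_size i by [].
rewrite leq_eqVlt => /orP[/eqP e|lt]; last by rewrite modn_small.
by rewrite e modnn iter_order.
Qed.

Lemma side_val_root s : froot nxt (side_val s) = val (tag s).
Proof.
case: s => i t; rewrite /side_val /=.
have csym := fconnect_sym nxt_inj.
rewrite -[RHS](eqP (valP i)); apply/eqP; rewrite root_connect // csym.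
exact: fconnect_iter.
Qed.

Lemma side_val_inj : injective side_val.
Proof.
move=> [i t] [j u] e.
have eij : i = j by apply: val_inj; rewrite -(side_val_root (existT _ i t)) e side_val_root.
case: _ / eij u e => u /(congr1 (findex nxt (val i))).
by rewrite /side_val /= !findex_iter // => /val_inj ->.
Qed.

Lemma froot_polygon x : froot nxt (froot nxt x) == froot nxt x.
Proof. by rewrite root_root //; exact: fconnect_sym. Qed.

Lemma val_side_subproof x :
  findex nxt (froot nxt x) x <
  orbit_size (exist _ (froot nxt x) (froot_polygon x) : orbit_polygon).
Proof.
rewrite /orbit_size /=; apply: findex_max.
by rewrite (fconnect_sym nxt_inj) connect_root.
Qed.

Definition val_side x : side orbit_size := Tagged _ (Ordinal (val_side_subproof x)).

Lemma val_sideK : cancel val_side side_val.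
Proof.
move=> x; rewrite /side_val /=; apply: iter_findex.
by rewrite (fconnect_sym nxt_inj) connect_root.
Qed.

Lemma side_valK : cancel side_val val_side.
Proof. by move=> s; apply: side_val_inj; rewrite val_sideK. Qed.

End OrbitPolygons.

Lemma card_sum_roots (T : finType) (e : rel T) : connect_sym e ->
  #|T| = \sum_(v in fingraph.roots e) #|[set u | fingraph.root e u == v]|.
Proof.
move=> csym; rewrite -sum1_card.
rewrite (partition_big (fingraph.root e) (fun v => v \in fingraph.roots e)) /=; last first.
  by move=> u _; apply: roots_root.
by apply: eq_bigr => v _; rewrite -sum1_card; apply: eq_bigl => u; rewrite !inE.
Qed.

Lemma n_comp_sum1 (T : finType) (e : rel T) :
  n_comp e predT = \sum_(v in fingraph.roots e) 1.
Proof. by rewrite sum1_card; apply: eq_card => v; rewrite !inE andbT. Qed.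

(** Count corners: there are as many corners as sides, that is two per edge. The vertices are the
    classes of corners; each class has at least two elements and the class of [x] has at least
    three. *)
Lemma num_vertices_lt (S : side_pairing) (x : side (@nsides S)) :
  (forall s : side (@nsides S), exists2 s', s' != s & glued s s') ->
  (exists y z, [/\ y != x, z != x, y != z, glued x y & glued x z]) ->
  num_vertices S < num_edges S.
Proof.
move=> h2 [y [z [yx zx yz gy gz]]].
have csym := @glued_connect_sym S.
pose r := fingraph.root (@glued S).
pose cls v : {set side (@nsides S)} := [set u | r u == v].
have rE u v : glued u v -> r v = r u by move=> g; apply/esym/eqP; rewrite root_connect // connect1.
have cls2 v : v \in fingraph.roots (@glued S) -> 2 <= #|cls v|.
  move=> /eqP rv; have [s' ns gs] := h2 v.
  have : [set v; s'] \subset cls v.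
    apply/fintype.subsetP => u; rewrite !inE => /orP[] /eqP ->; first exact/eqP.
    by rewrite (rE _ _ gs); apply/eqP.
  by move=> /subset_leq_card; rewrite cards2 eq_sym ns.
have cls3 : 3 <= #|cls (r x)|.
  have : [set x; y; z] \subset cls (r x).
    apply/fintype.subsetP => u; rewrite !inE => /orP[/orP[]|] /eqP -> //.
      by rewrite (rE _ _ gy).
    by rewrite (rE _ _ gz).
  move=> /subset_leq_card; apply: leq_trans.
  by rewrite -finset.setUA cardsU1 cards2 yz !inE negb_or ![x == _]eq_sym yx zx.
(* The number of sides is even because [mate] is an involution without fixed points, so the halving
   in [num_edges] is exact. *)
have [k ek] : exists k, #|side (@nsides S)| = k.*2.
  exists (fcard (@mate S) predT); rewrite -muln2; apply/esym.
  apply: (@fcard_order_set _ _ (inv_inj (@mateK S)) 2 predT) => //.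
  apply/fintype.subsetP => s _; rewrite inE; apply/eqP.
  apply: (@order_cycle _ _ [:: s; mate s]); rewrite ?inE ?eqxx //=.
    by rewrite mateK !eqxx.
  by rewrite inE eq_sym mate_neq.
rewrite /num_edges ek doubleK -ltn_double -ek.
rewrite (card_sum_roots csym) [num_vertices S]n_comp_sum1 -muln2 big_distrl /=.
have rx : r x \in fingraph.roots (@glued S) by apply: roots_root.
rewrite (bigD1 (r x)) // [X in _ < X](bigD1 (r x)) //=.
apply: (@leq_add 3) => //; apply: leq_sum => v /andP[rv _].
by rewrite mul1n cls2.
Qed.

(** * Surfaces carried by folded graphs *)

Lemma word_of_mul (u v : F2) : reduced (u ++ v) -> word_of (u * v)%g = u ++ v.
Proof.
move=> ruv; rewrite -[RHS]foldr_push_nil // foldr_cat.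
by rewrite [foldr push [::] v]foldr_push_nil ?word_ofP.
Qed.

Lemma word_of_expg (w : F2) k : cyclically_reduced w ->
  word_of (w ^+ k)%g = flatten (nseq k (word_of w)).
Proof.
rewrite /cyclically_reduced => cw.
elim: k => [|k IHk]; first by rewrite expg0.
rewrite expgS word_of_mul IHk //.
case: (word_of w) cw => [|x p]; first by rewrite cat0s; elim: k {IHk}.
rewrite (cycle_path x) => cw.
suff : path nocancel (last x p) (flatten (nseq k.+1 (x :: p))) by case/andP.
elim: {IHk} k.+1 => //= j IHj.
by rewrite cat_path IHj; move: cw => /= /andP[-> ->].
Qed.

Lemma nth_flatten_nseq (T : Type) (x0 : T) (s : seq T) k t :
  t < k * size s -> nth x0 (flatten (nseq k s)) t = nth x0 s (t %% size s).
Proof.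
elim: k t => [|k IHk] t; first by rewrite mul0n.
rewrite mulSn /= nth_cat => lt; case: ltnP => [h|h]; first by rewrite modn_small.
by rewrite IHk ?ltn_subLR // -{2}(subnK h) modnDr.
Qed.

Section FoldedSurface.
Variables (X : finType) (nxt : X -> X) (lab : X -> letter).
(** The sides run along a labelled graph: [ed x] is the edge below the side [x], [vt x] the vertex
    where [x] starts, and [origin l d] the vertex from which the edge [d] departs when it is read as
    [l]. The hypotheses say that each edge carries exactly two sides ([ed_fibre]) and that the graph
    is folded ([origin_inj]). *)
Variables (T : eqType) (V : Type) (ed : X -> T) (vt : X -> V) (origin : letter -> T -> V).
Hypothesis nxt_inj : injective nxt.
Hypothesis ed_fibre : forall x, exists2 y, y != x &
  forall z, (ed z == ed x) = (z == x) || (z == y).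
Hypothesis ed_gen : forall x y, ed x = ed y -> (lab x).1 = (lab y).1.
Hypothesis start_origin : forall x, vt x = origin (lab x) (ed x).
Hypothesis end_origin : forall x, vt (nxt x) = origin (linv (lab x)) (ed x).
Hypothesis origin_inj : forall x y l, l.1 = (lab x).1 -> l.1 = (lab y).1 ->
  origin l (ed x) = origin l (ed y) -> ed x = ed y.
Hypothesis lab_nocancel : forall x, nocancel (lab x) (lab (nxt x)).

Definition other x := odflt x [pick y | (y != x) && (ed y == ed x)].

Lemma otherP x : [/\ other x != x, ed (other x) = ed x &
  forall z, ed z = ed x -> z = x \/ z = other x].
Proof.
have [y yx fib] := ed_fibre x; rewrite /other; case: pickP => [z|h] /=.
  case/andP=> zx /eqP ez; split=> // u /eqP; rewrite fib.
  have /orP[|/eqP zy] : (z == x) || (z == y) by rewrite -fib ez.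
    by rewrite (negbTE zx).
  by rewrite zy => /orP[] /eqP; [left|right].
by have := h y; rewrite yx fib eqxx orbT.
Qed.

Lemma otherK : involutive other.
Proof.
move=> x; have [ox ex fx] := otherP x; have [oy ey fy] := otherP (other x).
have [//|e] := fx _ (etrans ey ex).
by move: oy; rewrite e eqxx.
Qed.

Lemma other_neq x : other x != x. Proof. by case: (otherP x). Qed.

Definition reversed x := lab (other x) != lab x.

Lemma lab_other x : lab (other x) = if reversed x then linv (lab x) else lab x.
Proof.
rewrite /reversed; case: eqP => //= ne; have [_ ex _] := otherP x.
move: (ed_gen ex) ne; case: (lab x) => a s; case: (lab _) => a' s' /= ->.
by case: s s' => [] [].
Qed.

Lemma reversed_other x : reversed (other x) = reversed x.
Proof. by rewrite /reversed otherK eq_sym. Qed.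

Local Notation g := (@side_val X nxt).
Local Notation h := (@val_side X nxt nxt_inj).

Definition folded_mate (s : side (@orbit_size X nxt)) := h (other (g s)).

Lemma folded_mateK : involutive folded_mate.
Proof. by move=> s; rewrite /folded_mate val_sideK otherK side_valK. Qed.

Lemma folded_mate_neq s : folded_mate s != s.
Proof.
by rewrite -(inj_eq (@side_val_inj _ _ nxt_inj)) val_sideK other_neq.
Qed.

Lemma folded_flip_mate s : reversed (g (folded_mate s)) = reversed (g s).
Proof. by rewrite val_sideK reversed_other. Qed.

Definition folded_surface : side_pairing :=
  @SidePairing (orbit_polygon nxt) _ (@orbit_size_gt0 _ nxt) _
    folded_mateK folded_mate_neq (fun s => reversed (g s)) folded_flip_mate.

Local Notation S := folded_surface.
Local Notation labS := (fun s : side (@nsides S) => lab (g s)).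

Lemma folded_graph_map : is_graph_map (S := S) labS.
Proof.
move=> [s d]; rewrite /dlabel /dmate /= val_sideK lab_other.
by case: reversed d => [] [] /=; rewrite ?linvK.
Qed.

Lemma ed_dmate (z : dside S) : ed (g (dmate z).1) = ed (g z.1).
Proof. by rewrite /= val_sideK; case: (otherP (g z.1)). Qed.

Lemma dstart_origin (z : dside S) :
  vt (g (dstart z)) = origin (dlabel labS z) (ed (g z.1)).
Proof.
case: z => s [] /=; rewrite /dstart /dlabel /= ?side_val_next //.
Qed.

(** Glued corners lie over one vertex of the graph. Several vertices of the surface may lie over the
    same graph vertex; local injectivity on the 1-skeleton is still inherited from foldedness. *)
Lemma same_vertex_vt (s s' : side (@nsides S)) :
  same_vertex s s' -> vt (g s) = vt (g s').
Proof.
case/connectP=> p + ->; elim: p s => //= t p IHp s /andP[/existsP[z /andP[/eqP -> /eqP e]] /IHp <-].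
by rewrite e !dstart_origin ed_dmate folded_graph_map.
Qed.

Lemma dlabel_gen (z : dside S) : (dlabel labS z).1 = (lab (g z.1)).1.
Proof. by case: z => s []. Qed.

Lemma dlabel_inj (s : side (@nsides S)) d d' :
  dlabel (S := S) labS (s, d) = dlabel (S := S) labS (s, d') -> d = d'.
Proof. by rewrite /dlabel /=; case: (lab (g s)) d d' => a [] [] []. Qed.

Lemma folded_immersion : is_immersion (S := S) labS.
Proof.
split; first exact: folded_graph_map.
move=> z z' /same_vertex_vt; rewrite !dstart_origin => eo el.
rewrite el in eo.
have el1 : (dlabel labS z').1 = (lab (g z.1)).1 by rewrite -el dlabel_gen.
have ee := origin_inj el1 (dlabel_gen z') eo.
have [_ _ /(_ _ (esym ee)) []] := otherP (g z.1).
  move=> /(side_val_inj nxt_inj); case: z z' el {eo el1 ee} => s d [s' d'] /= el e.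
  by left; rewrite e in el *; rewrite (dlabel_inj el).
move=> e; right; have e1 : z'.1 = (dmate z).1 by rewrite -(side_valK nxt_inj z'.1) e.
move: el; rewrite -folded_graph_map; case: z' (dmate z) e1 {eo el1 ee e} => s d [s' d'] /= <-.
by move/dlabel_inj ->.
Qed.

Lemma folded_boundary_immersed : boundary_immersed (S := S) labS.
Proof. by move=> s; rewrite side_val_next. Qed.

(** If a corner were glued to itself, either two consecutive sides would carry inverse letters,
    against [lab_nocancel], or [other] would have a fixed point. *)
Lemma dstart_dmate_neq (z : dside S) : dstart (dmate z) != dstart z.
Proof.
rewrite -(inj_eq (side_val_inj nxt_inj)).
have side_nextE s : g (next_side s) = nxt (g s) by exact: side_val_next.
have lin a : lab (nxt a) = linv (lab a) -> False.
  by move=> e; have := lab_nocancel a; rewrite e /nocancel eqxx.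
case: z => s d; rewrite /dstart /dmate /=.
have := lab_other (g s); have := other_neq (g s).
case: reversed d => [] [] /= ne el; rewrite ?side_nextE ?val_sideK //.
- by apply/eqP => e; apply: (@lin (g s)); rewrite -e.
- by apply/eqP => e; apply: (@lin (other (g s))); rewrite e el linvK.
- by rewrite (inj_eq nxt_inj).
Qed.

Lemma glued_dmate (z : dside S) : glued (dstart z) (dstart (dmate z)).
Proof. by apply/existsP; exists z; rewrite !eqxx. Qed.

(* At the corner between [u] and [nxt u] this says that the two sides glued to
   [u] and to [nxt u] do not meet at a common corner, so that the link of the
   vertex is not a bigon. *)
Hypothesis branching : exists u v, [/\ ed u = ed (nxt v), lab u != lab (nxt v)
  & lab v != linv (lab (nxt u))].

(** By [dstart_dmate_neq] each vertex has at least two corners. The branching corner between [u] and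
    [nxt u] is glued to different corners across [u] and across [nxt u], which yields a vertex with
    three. *)
Lemma folded_euler_char : (euler_char S < (num_faces S)%:Z)%R.
Proof.
have [u [v [euv luv lvu]]] := branching.
have side_nextE s : g (next_side s) = nxt (g s) by exact: side_val_next.
have nv : nxt v = other u.
  have [_ _ /(_ _ (esym euv)) []//] := otherP u.
  by move=> e; rewrite e eqxx in luv.
have ru : reversed u by rewrite /reversed -nv eq_sym.
suff lt : num_vertices S < num_edges S.
  rewrite /euler_char -[ltRHS]GRing.add0r Num.Theory.ltrD2r Num.Theory.subr_lt0.
  by rewrite ltz_nat.
(* These are the two directed sides that leave the corner between [u] and [nxt u]. *)
pose zu : dside S := (h u, true); pose zx : dside S := (h (nxt u), false).
have xE : dstart zu = dstart zx.
  by apply: (side_val_inj nxt_inj); rewrite /dstart /= side_nextE !val_sideK.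
apply: (num_vertices_lt (x := dstart zx)) => [s|].
  exists (dstart (dmate ((s, false) : dside S))); last exact: (glued_dmate (s, false)).
  exact: (dstart_dmate_neq (s, false)).
exists (dstart (dmate zx)), (dstart (dmate zu)); split.
- exact: dstart_dmate_neq.
- by rewrite -xE dstart_dmate_neq.
- rewrite -(inj_eq (side_val_inj nxt_inj)) /dstart /dmate /= !val_sideK ru /=.
  rewrite !val_sideK -nv; have := lab_other (nxt u).
  case: reversed => /= el; last first.
    rewrite !val_sideK; apply/eqP => e; have := lab_nocancel u.
    by rewrite /nocancel -el e nv lab_other ru eqxx.
  rewrite side_nextE !val_sideK (inj_eq nxt_inj); apply/eqP => e.
  by rewrite -e el eqxx in lvu.
- exact: glued_dmate.
- by rewrite -xE glued_dmate.
Qed.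

Variables (w : F2) (l0 : letter) (pos : X -> nat).
Hypothesis w_cyc : cyclically_reduced w.
Hypothesis pos_lt : forall x, pos x < size w.
Hypothesis pos_nxt : forall x, pos (nxt x) = (pos x).+1 %% size w.
Hypothesis lab_pos : forall x, lab x = nth l0 w (pos x).

Lemma pos_iter t x : pos (iter t nxt x) = (pos x + t) %% size w.
Proof.
elim: t => [|t IHt] /=; first by rewrite addn0 modn_small.
by rewrite pos_nxt IHt -addn1 modnDml addn1 addnS.
Qed.

(** Along an orbit the position in [w] advances by one modulo [size w], so the length of the orbit
    is a multiple of [size w]. The reading starts at a side of position 0, reached from the root
    after [size w - pos r] steps. *)
Lemma folded_reads_powers : reads_powers (S := S) w labS.
Proof.
move=> i; set r := val i; set n := fingraph.order nxt r.
pose j := size w - pos r.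
pose nx := @next_side _ (@orbit_size X nxt).
pose s0 : side (@orbit_size X nxt) := Tagged _ (Ordinal (orbit_size_gt0 i)).
have g_iter t s1 : g (iter t nx s1) = iter t nxt (g s1).
  by elim: t => //= t <-; rewrite side_val_next.
have tag_iter t s1 : tag (iter t nx s1) = tag s1 by elim: t.
pose s := iter j nx s0.
have gsE : g s = iter j nxt r by rewrite g_iter.
have ps : pos (g s) = 0 by rewrite gsE pos_iter subnKC ?modnn // ltnW.
have ts : tag s = i by rewrite tag_iter.
have wgt0 : 0 < size w by apply: leq_trans (pos_lt r).
have gn : iter n nxt (g s) = g s.
  by rewrite gsE -iterD addnC iterD iter_order.
have /dvdnP[k nk] : size w %| n by rewrite /dvdn -[X in X %% _]add0n -ps -pos_iter gn ps.
exists s => //; exists (Posz k).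
  move=> [k0]; move: nk; rewrite k0 mul0n => n0.
  by have := order_gt0 nxt r; rewrite -/n n0.
rewrite /= word_of_expg // /boundary_word ts.
have szw : size (flatten (nseq k (word_of w))) = n.
  by rewrite size_flatten /shape map_nseq sumn_nseq mulnC.
apply: (@eq_from_nth _ l0); first by rewrite szw size_map size_traject.
rewrite size_map size_traject => t lt.
rewrite (nth_map s) ?size_traject // nth_traject // g_iter lab_pos pos_iter ps add0n.
by rewrite nth_flatten_nseq // -nk.
Qed.

Theorem folded_polygonal : polygonal w.
Proof.
exists S; split; last exact: folded_euler_char.
exists labS; split; [exact: folded_immersion|exact: folded_boundary_immersed|].
exact: folded_reads_powers.
Qed.

End FoldedSurface.

(** * Blocks winding around circles *)

(* The segments [v e, v e + len e), for [e] in [D], tile the circle of length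
   [L] and [st] maps each of them to the one that follows it. *)
Definition winds (E : Type) (L : nat) (D : pred E) (len v : E -> nat) (st : E -> E) : Prop :=
  [/\ forall e, D e -> D (st e),
      forall e, D e -> v (st e) = (v e + len e) %% L,
      forall e s, D e -> s < len e -> v e + s < L,
      forall n, n < L -> exists e s, [/\ D e, s < len e & n = v e + s]
    & forall e e' s s', D e -> D e' -> s < len e -> s' < len e' ->
        v e + s = v e' + s' -> e = e' /\ s = s'].

Lemma modn_end_inj L m n : 0 < m <= L -> 0 < n <= L -> m %% L = n %% L -> m = n.
Proof.
move=> /andP[m0 mL] /andP[n0 nL].
move: mL nL; rewrite [m <= L]leq_eqVlt [n <= L]leq_eqVlt => /orP[/eqP ->|mL] /orP[/eqP ->|nL] //;
  rewrite ?modnn ?(modn_small mL) ?(modn_small nL) //; lia.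
Qed.

(** Two segments with the same successor end at the same point of the circle, so they share their
    last unit interval and coincide. *)
Lemma winds_inj E L (D : pred E) len v st e e' : winds L D len v st ->
  (forall e, 0 < len e) -> D e -> D e' -> st e = st e' -> e = e'.
Proof.
move=> [_ hst hL _ huniq] len0 De De' est.
have le := len0 e; have le' := len0 e'.
have b1 := hL e (len e).-1 De ltac:(lia); have b2 := hL e' (len e').-1 De' ltac:(lia).
have /modn_end_inj h : (v e + len e) %% L = (v e' + len e') %% L by rewrite -!hst ?est.
have {}h : v e + len e = v e' + len e' by apply: h; lia.
by have [||//|//] := @huniq e e' (len e).-1 (len e').-1 De De'; lia.
Qed.

Section CircleGraph.
(** [E] indexes the copies of the blocks: the p-block [inl e] reads a power of [al] and then
    [linv be], the q-block [inr e] a power of [al'] and then [be]. The p-blocks in [D] tile the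
    circle with successor [P], the q-blocks with successor [Q]; a p-block outside [D] winds around a
    loop of its own. *)
Variables (E : finType) (D : pred E) (plen qlen : E -> nat) (P Q : E -> E).
Variables (L : nat) (vp vq : E -> nat) (al al' be : letter).
Hypothesis plen_gt0 : forall e, 0 < plen e.
Hypothesis qlen_gt0 : forall e, 0 < qlen e.
Hypothesis windsP : winds L D plen vp P.
Hypothesis windsQ : winds L predT qlen vq Q.
Hypothesis plenC : forall e, ~~ D e -> plen e = 2.
Hypothesis P_fix : forall e, ~~ D e -> P e = e.
Hypothesis al_gen : al.1 = false.
Hypothesis al'_gen : al'.1 = false.
Hypothesis be_gen : be.1 = true.

Definition blen (b : E + E) : nat := match b with inl e => plen e | inr e => qlen e end.

(* The last side of a block carries the letter [be^-1] for the left summand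
   and [be] for the right one. *)
Definition bside : finType := {b : E + E & 'I_(blen b).+1}.

Definition mkside (b : E + E) (t : nat) : bside :=
  Tagged (fun b => 'I_(blen b).+1) (inord t : 'I_(blen b).+1).

Definition bnum (x : bside) : nat := tagged x.

Definition bsucc (b : E + E) : E + E :=
  match b with inl e => inr e | inr e => inl (P (Q e)) end.

Definition bnext (x : bside) : bside :=
  if bnum x < blen (tag x) then mkside (tag x) (bnum x).+1 else mkside (bsucc (tag x)) 0.

Definition blab (x : bside) : letter :=
  match tag x with
  | inl _ => if bnum x < blen (tag x) then al else linv be
  | inr _ => if bnum x < blen (tag x) then al' else be
  end.

(* If [al' = linv al] the second family of blocks runs around the circle in the
   opposite direction. *)
Definition mirror (n : nat) : nat := if al' == al then n else L.-1 - n.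

(** In the mirrored case the q-position [n] sits at the point [-n] modulo [L], so that the unit
    interval after [n] is the circle edge [mirror n]. The vertex [inr e] carries the loop of a
    p-block outside [D]. *)
Definition bvert (b : E + E) (t : nat) : nat + E :=
  match b with
  | inl e => if D e then inl ((vp e + t) %% L) else inr e
  | inr e => inl (if al' == al then (vq e + t) %% L else (L - (vq e + t) %% L) %% L)
  end.

(** Here [inl (inl n)] is the circle edge from [n] to [n + 1] in the direction of [al],
    [inl (inr e)] is a loop, and [inr e] is a b-edge. *)
Definition bedge (b : E + E) (t : nat) : (nat + E) + E :=
  match b with
  | inl e => if t < plen e then inl (if D e then inl (vp e + t) else inr e) else inr e
  | inr e => if t < qlen e then inl (inl (mirror (vq e + t))) else inr (Q e)
  end.

Definition borigin (l : letter) (d : (nat + E) + E) : nat + E :=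
  match d with
  | inl (inl n) => inl (if l == al then n else n.+1 %% L)
  | inl (inr e) => inr e
  | inr e => if l == be then bvert (inr e) 0 else bvert (inl (P e)) 0
  end.

Lemma bside_eq (x y : bside) : tag x = tag y -> bnum x = bnum y -> x = y.
Proof.
case: x y => b t [b' t'] /= e; case: _ / e t' => t'; rewrite /bnum /= => /val_inj -> //.
Qed.

Lemma bnum_le (x : bside) : bnum x <= blen (tag x).
Proof. by rewrite -ltnS; exact: (ltn_ord (tagged x)). Qed.

Lemma bnum_mkside b t : t <= blen b -> bnum (mkside b t) = t.
Proof. by move=> h; rewrite /bnum /= inordK. Qed.

Lemma P_inj : injective P.
Proof.
move=> e e'; have [De|De] := boolP (D e); have [De'|De'] := boolP (D e').
- exact: (winds_inj windsP).
- by move=> h; case: windsP => /(_ e De); rewrite h P_fix // (negbTE De').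
- by move=> h; case: windsP => /(_ e' De'); rewrite -h P_fix // (negbTE De).
- by rewrite !P_fix.
Qed.

Lemma Q_inj : injective Q.
Proof. by move=> e e'; exact: (winds_inj windsQ). Qed.

Lemma bsucc_inj : injective bsucc.
Proof. by move=> [e|e] [e'|e'] //= []; [move=> ->|move/P_inj/Q_inj ->]. Qed.

Lemma bnext_inj : injective bnext.
Proof.
move=> x y; rewrite /bnext; have := bnum_le x; have := bnum_le y.
case: ifP => hx; case: ifP => hy by_ bx e.
- have et : tag x = tag y by exact: (congr1 tag e).
  apply: bside_eq => //; apply/eqP; rewrite -eqSS -(bnum_mkside hx) e bnum_mkside //.
- have := congr1 bnum e; rewrite !bnum_mkside //.
- have := congr1 bnum e; rewrite !bnum_mkside //.
- have et : tag x = tag y by apply: bsucc_inj; exact: (congr1 tag e).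
  by apply: bside_eq => //; rewrite -et in hy by_ *; lia.
Qed.

Lemma vp_lt e t : D e -> t < plen e -> vp e + t < L.
Proof. by case: windsP => _ _ h _ _; exact: h. Qed.

Lemma vq_lt e t : t < qlen e -> vq e + t < L.
Proof. by case: windsQ => _ _ h _ _; exact: h. Qed.

Lemma bvert_end b :
  bvert b (blen b) = bvert (match b with inl e => inl (P e) | inr e => inr (Q e) end) 0.
Proof.
case: b => e /=; last first.
  by case: windsQ => _ -> // _ _ _; rewrite addn0 modn_mod.
have [De|De] := boolP (D e); last by rewrite P_fix // (negbTE De).
by case: windsP => /(_ e De) -> -> // _ _ _; rewrite addn0 modn_mod.
Qed.

Lemma linv_neq (l : letter) : (linv l == l) = false.
Proof. by case: l => a [] /=; case: a. Qed.

Lemma al'E : al' <> al -> al' = linv al.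
Proof.
by case: al al' al_gen al'_gen => a s [a' s'] /= -> ->; case: s s' => [] [].
Qed.

Lemma bstart_origin (x : bside) :
  bvert (tag x) (bnum x) = borigin (blab x) (bedge (tag x) (bnum x)).
Proof.
have := bnum_le x; rewrite /blab; case: (tag x) => e /= le.
  case: ltnP => lt; first by case: ifP => De //; rewrite /borigin eqxx modn_small ?vp_lt.
  have -> : bnum x = plen e by lia.
  by rewrite /borigin linv_neq; exact: (bvert_end (inl e)).
case: (ltnP _ (qlen e)) => lt; last first.
  have -> : bnum x = qlen e by lia.
  by rewrite /borigin eqxx; exact: (bvert_end (inr e)).
rewrite /borigin /mirror; have := vq_lt lt; have [_|_] := eqVneq al' al => h.
  by rewrite modn_small.
by rewrite (modn_small h); congr inl; congr modn; lia.
Qed.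

Lemma bend_origin (x : bside) :
  bvert (tag (bnext x)) (bnum (bnext x)) =
  borigin (linv (blab x)) (bedge (tag x) (bnum x)).
Proof.
rewrite /bnext; have := bnum_le x; case: ifP => lt le; rewrite bnum_mkside //=.
  move: lt {le}; rewrite /blab; case: (tag x) => e /= lt; rewrite lt /=.
    by case: ifP => De //=; rewrite linv_neq addnS.
  rewrite /mirror addnS; have := vq_lt lt; have [->|ne] := eqVneq al' al => h.
    by rewrite linv_neq.
  rewrite (al'E (elimN eqP ne)) linvK eqxx; congr inl; move: h; rewrite leq_eqVlt.
  case/orP=> [/eqP <-|h]; first by rewrite modnn subn0 modnn /= subnn.
  by rewrite (modn_small h) modn_small; lia.
have bE : bnum x = blen (tag x) by lia.
rewrite /blab bE; case: (tag x) => e; rewrite /blen /bedge ltnn /borigin.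
  by rewrite linvK eqxx.
by rewrite linv_neq.
Qed.

Lemma bedge_gen (x y : bside) : bedge (tag x) (bnum x) = bedge (tag y) (bnum y) ->
  (blab x).1 = (blab y).1.
Proof.
have labE (z : bside) : (blab z).1 = if bedge (tag z) (bnum z) is inr _ then true else false.
  by rewrite /blab; case: (tag z) => e /=; case: ifP => //=.
by rewrite !labE => ->.
Qed.

Lemma bedge_lt (x : bside) n : bedge (tag x) (bnum x) = inl (inl n) -> n < L.
Proof.
case: (tag x) => e /=; case: ifP => lt //.
  by case: ifP => De // [<-]; exact: vp_lt.
by case=> <-; rewrite /mirror; have := vq_lt lt; case: ifP; lia.
Qed.

Lemma bvertP0_inj e e' : bvert (inl (P e)) 0 = bvert (inl (P e')) 0 -> e = e'.
Proof.
move=> h; apply: P_inj; move: (P e) (P e') h => {}e {}e' /=.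
case: ifP => De; case: ifP => De' // [] //; rewrite !addn0.
have h := vp_lt De (plen_gt0 e); have h' := vp_lt De' (plen_gt0 e').
rewrite !modn_small; [|lia..] => ev.
case: windsP => _ _ _ _ /(_ e e' 0 0 De De') []; rewrite ?addn0 //.
Qed.

Lemma bvertQ0_inj e e' : bvert (inr e) 0 = bvert (inr e') 0 -> e = e'.
Proof.
rewrite /= !addn0 => -[]; have := vq_lt (qlen_gt0 e); have := vq_lt (qlen_gt0 e').
rewrite !addn0 => h' h; rewrite !(modn_small h) !(modn_small h') => ev.
have {}ev : vq e = vq e'.
  move: ev; case: ifP => // _.
  have [->|n0] := posnP (vq e); have [->|n0'] := posnP (vq e') => //;
    rewrite ?subn0 ?modnn ?modn_small //; lia.
case: windsQ => _ _ _ _ /(_ e e' 0 0) []; rewrite ?addn0 //.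
Qed.

(** Foldedness: on the circle and on the loops one a-edge leaves each vertex in each direction, and
    b-edges with the same origin agree because distinct blocks of one family start at distinct
    points. *)
Lemma borigin_inj (x y : bside) l : l.1 = (blab x).1 -> l.1 = (blab y).1 ->
  borigin l (bedge (tag x) (bnum x)) = borigin l (bedge (tag y) (bnum y)) ->
  bedge (tag x) (bnum x) = bedge (tag y) (bnum y).
Proof.
have labE (z : bside) : (blab z).1 = if bedge (tag z) (bnum z) is inr _ then true else false.
  by rewrite /blab; case: (tag z) => e /=; case: ifP => //=.
have := @bedge_lt x; have := @bedge_lt y; rewrite !labE.
move: (bedge _ _) (bedge _ _) => [[n|e]|e] [[n'|e']|e'] //= hn hn' -> //= _.
- have {}hn := hn _ erefl; have {}hn' := hn' _ erefl.
  case: ifP => _ [] => [-> //|/modn_end_inj h]; do 2 congr inl.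
  by apply: succn_inj; apply: h; lia.
- by case=> ->.
- by case: ifP => _ => [/bvertQ0_inj|/bvertP0_inj] ->.
Qed.

Definition isl (b : E + E) : bool := if b is inl _ then true else false.

Lemma mirrorK n : n < L -> mirror (mirror n) = n.
Proof. by rewrite /mirror => h; case: (al' == al); lia. Qed.

Lemma mirror_lt n : n < L -> mirror n < L.
Proof. by rewrite /mirror => h; case: (al' == al); lia. Qed.

Lemma bedge_inj (x y : bside) : isl (tag x) = isl (tag y) ->
  bedge (tag x) (bnum x) = bedge (tag y) (bnum y) ->
  (forall e, bedge (tag x) (bnum x) <> inl (inr e)) -> x = y.
Proof.
move=> hl he hn; have [<-//|] := eqVneq x y; apply: contraNeq => _.
have := bnum_le x; have := bnum_le y; move: hl he hn.
move et : (tag x) => b; move et' : (tag y) => b'.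
suff h : isl b = isl b' -> bedge b (bnum x) = bedge b' (bnum y) ->
  (forall e, bedge b (bnum x) <> inl (inr e)) -> bnum y <= blen b' -> bnum x <= blen b ->
  b = b' /\ bnum x = bnum y.
  move=> h1 h2 h3 h4 h5; have [eb en] := h h1 h2 h3 h4 h5.
  by apply/eqP/bside_eq; rewrite ?et ?et'.
case: b {et} => e; case: b' {et'} => e' //= _;
  case: (boolP (bnum x < _)) => lt; case: (boolP (bnum y < _)) => lt' //.
- case: ifP => De; last by move=> _ /(_ e) [].
  case: ifP => De' // [] ev _ _ _.
  by case: windsP => _ _ _ _ /(_ e e' _ _ De De' lt lt' ev) [-> ->].
- rewrite -!leqNgt in lt lt'; move=> [ee]; rewrite -ee in lt' * => _ hy hx; split=> //.
  by apply: etrans (_ : _ = plen e) _; [|apply/esym]; apply/anti_leq/andP.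
- case=> /(congr1 mirror); rewrite !mirrorK ?vq_lt // => ev _ _ _.
  by case: windsQ => _ _ _ _ /(_ e e' _ _ isT isT lt lt' ev) [-> ->].
- rewrite -!leqNgt in lt lt'; move=> [/Q_inj ee]; rewrite -ee in lt' * => _ hy hx; split=> //.
  by apply: etrans (_ : _ = qlen e) _; [|apply/esym]; apply/anti_leq/andP.
Qed.

Lemma Q_surj e : exists f, Q f = e.
Proof. by have [f fK Kf] := injF_bij Q_inj; exists (f e). Qed.

Lemma bedge_ex (x : bside) : (forall e, bedge (tag x) (bnum x) <> inl (inr e)) ->
  exists y : bside, isl (tag y) != isl (tag x) /\
    bedge (tag y) (bnum y) = bedge (tag x) (bnum x).
Proof.
case: (tag x) => e /=; case: (boolP (bnum x < _)) => lt.
- case: ifP => De; last by move=> /(_ e) [].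
  case: windsQ => _ _ _ /(_ (mirror (vp e + bnum x)) (mirror_lt (vp_lt De lt)))
    [e' [s [_ lt' ev]]] _ _.
  exists (mkside (inr e') s); split=> //=.
  by rewrite bnum_mkside /= ?lt' -?ev ?mirrorK ?vp_lt // ltnW.
- move=> _; have [f <-] := Q_surj e; exists (mkside (inr f) (qlen f)); split=> //=.
  by rewrite bnum_mkside //= ltnn.
- case: windsP => _ _ _ /(_ _ (mirror_lt (vq_lt lt))) [e' [s [De' lt' ev]]] _ _.
  exists (mkside (inl e') s); split=> //=.
  by rewrite bnum_mkside /= ?lt' ?De' -?ev // ltnW.
- move=> _; exists (mkside (inl (Q e)) (plen (Q e))); split=> //=.
  by rewrite bnum_mkside //= ltnn.
Qed.

(** A loop carries the two a-sides of its p-block, which has length 2 by [plenC]. Every other edge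
    is covered at most once by each family ([bedge_inj]) and is met by both ([bedge_ex]). *)
Lemma bedge_fibre (x : bside) : exists2 y, y != x & forall z : bside,
  (bedge (tag z) (bnum z) == bedge (tag x) (bnum x)) = (z == x) || (z == y).
Proof.
have [[e xe]|xe] := pselect (exists e, bedge (tag x) (bnum x) = inl (inr e)).
  have xE (z : bside) : bedge (tag z) (bnum z) = inl (inr e) ->
      [/\ tag z = inl e, bnum z < 2 & ~~ D e].
    case: (tag z) => f /=; case: (boolP (bnum z < _)) => // lt; case: ifP => // /negbT Df [<-].
    by rewrite (plenC Df) in lt.
  have [tx nx De] := xE x xe.
  have le : 1 - bnum x <= blen (inl e) by rewrite /= plenC //; lia.
  exists (mkside (inl e) (1 - bnum x)).
    by apply/eqP => /(congr1 bnum); rewrite bnum_mkside //; lia.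
  move=> z; rewrite xe; apply/eqP/orP.
    move=> /xE[tz nz _]; have [h|h] := eqVneq (bnum z) (bnum x); [left|right].
      by apply/eqP/bside_eq; rewrite ?tx.
    apply/eqP/bside_eq => //=; rewrite bnum_mkside //; move/eqP: h; lia.
  case=> /eqP -> //=; rewrite bnum_mkside //= plenC // (negbTE De).
  by rewrite (_ : 1 - bnum x < 2) //; lia.
have hx e : bedge (tag x) (bnum x) <> inl (inr e) by move=> h; apply: xe; exists e.
have [y [ly ey]] := bedge_ex hx.
exists y; first by apply: contraNneq ly => ->.
move=> z; apply/eqP/orP => [ez|[] /eqP -> //].
have [lz|lz] := boolP (isl (tag z) == isl (tag x)); [left|right]; apply/eqP.
  by apply: bedge_inj => [||e]; rewrite ?ez //; apply/eqP.
apply: bedge_inj => [||e]; rewrite ?ez ?ey //.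
by move: ly lz; do 2 case: isl; case: isl.
Qed.

Lemma blab_nocancel (x : bside) : nocancel (blab x) (blab (bnext x)).
Proof.
have gen_neq (l l' : letter) : l.1 != l'.1 -> nocancel l l'.
  by rewrite /nocancel eq_sym => h; apply: contraNneq h => ->.
rewrite /bnext; case: ifP => lt; rewrite {2}/blab bnum_mkside //=.
  rewrite /blab; move: lt; case: (tag x) => e /= lt; rewrite lt; case: ifP => lt'.
  - by rewrite /nocancel eq_sym linv_neq.
  - by apply: gen_neq; rewrite al_gen /= be_gen.
  - by rewrite /nocancel eq_sym linv_neq.
  - by apply: gen_neq; rewrite al'_gen be_gen.
rewrite /blab; move: lt; case: (tag x) => e /= ->; apply: gen_neq.
  by rewrite qlen_gt0 al'_gen /= be_gen.
by rewrite plen_gt0 al_gen be_gen.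
Qed.

Lemma bedge_branching (e : E) : exists u v : bside,
  [/\ bedge (tag u) (bnum u) = bedge (tag (bnext v)) (bnum (bnext v)),
      blab u != blab (bnext v) & blab v != linv (blab (bnext u))].
Proof.
(* At the end of the p-block [Q e] the b-edge [Q e] meets an incoming and an outgoing side, both
   labelled [al]; these are not inverse letters, so the link there is not a bigon. *)
exists (mkside (inr e) (qlen e)), (mkside (inl (Q e)) (plen (Q e)).-1).
have lt : (plen (Q e)).-1 < plen (Q e) by rewrite prednK.
have -> : bnext (mkside (inl (Q e)) (plen (Q e)).-1) = mkside (inl (Q e)) (plen (Q e)).
  by rewrite /bnext bnum_mkside /= ?lt ?prednK // ltnW.
have -> : bnext (mkside (inr e) (qlen e)) = mkside (inl (P (Q e))) 0.
  by rewrite /bnext bnum_mkside //= ltnn.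
rewrite /blab /= !bnum_mkside //=; last exact: ltnW.
rewrite !ltnn lt plen_gt0; split=> //; last by rewrite eq_sym linv_neq.
by rewrite eq_sym linv_neq.
Qed.

(** * Positions of the sides in the block word *)

Variables (bs : seq (nat * nat)) (typ : E -> nat).
Hypothesis typ_lt : forall e, typ e < size bs.
Hypothesis typ_next : forall e, typ (P (Q e)) = (typ e).+1 %% size bs.
Hypothesis plen_typ : forall e, plen e = (nth (0, 0) bs (typ e)).1.
Hypothesis qlen_typ : forall e, qlen e = (nth (0, 0) bs (typ e)).2.

Definition block_seq (pq : nat * nat) : seq letter :=
  nseq pq.1 al ++ linv be :: rcons (nseq pq.2 al') be.

Definition blocks_seq : seq letter := flatten [seq block_seq pq | pq <- bs].

Definition boffset (i : nat) : nat := sumn (take i (shape [seq block_seq pq | pq <- bs])).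

(** A q-block is preceded by its p-block and one letter [linv be], whence the shift by
    [(plen e).+1]. *)
Definition bpos (x : bside) : nat :=
  match tag x with
  | inl e => boffset (typ e) + bnum x
  | inr e => boffset (typ e) + ((plen e).+1 + bnum x)
  end.

Lemma size_block_seq pq : size (block_seq pq) = pq.1 + pq.2 + 2.
Proof. by rewrite size_cat /= size_rcons !size_nseq; lia. Qed.

Lemma boffsetS i : i < size bs ->
  boffset i.+1 = boffset i + size (block_seq (nth (0, 0) bs i)).
Proof.
move=> lt; rewrite /boffset (take_nth 0) ?sumn_rcons ?size_map //.
by rewrite (nth_map [::]) ?size_map // (nth_map (0, 0)).
Qed.

Lemma boffset_size : boffset (size bs) = size blocks_seq.
Proof. by rewrite /boffset take_oversize ?size_map // -size_flatten. Qed.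

Lemma nth_flatten_offset (T : Type) (x0 : T) (ss : seq (seq T)) i t :
  i < size ss -> t < size (nth [::] ss i) ->
  nth x0 (flatten ss) (sumn (take i (shape ss)) + t) = nth x0 (nth [::] ss i) t.
Proof.
elim: ss i => // s ss IH [|i] /= hi ht; first by rewrite nth_cat ht.
by rewrite nth_cat -addnA ltnNge leq_addr /= addKn IH.
Qed.

Lemma flatten_offset_lt (T : Type) (ss : seq (seq T)) i t :
  i < size ss -> t < size (nth [::] ss i) ->
  sumn (take i (shape ss)) + t < size (flatten ss).
Proof.
elim: ss i => // s ss IH [|i] /= hi ht; rewrite size_cat.
  exact: leq_trans ht (leq_addr _ _).
by rewrite -addnA ltn_add2l IH.
Qed.

Lemma nth_block e :
  nth [::] [seq block_seq pq | pq <- bs] (typ e) = block_seq (plen e, qlen e).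
Proof. by rewrite (nth_map (0, 0)) // plen_typ qlen_typ -surjective_pairing. Qed.

Lemma bpos_lt x : bpos x < size blocks_seq.
Proof.
rewrite /bpos; have := bnum_le x; case: (tag x) => e /= le;
  apply: flatten_offset_lt; rewrite ?size_map // nth_block size_block_seq /=; lia.
Qed.

Lemma blab_pos x : blab x = nth al blocks_seq (bpos x).
Proof.
rewrite /bpos /blab; have := bnum_le x; case: (tag x) => e /= le;
  rewrite nth_flatten_offset ?size_map // nth_block ?size_block_seq /=; try lia.
  rewrite nth_cat size_nseq nth_nseq; case: ifP => // lt.
  by rewrite (_ : bnum x - plen e = 0) //; lia.
rewrite nth_cat size_nseq /= addSnnS [_ + _ < _]ltnNge leq_addr /= addKn /=.
rewrite nth_rcons size_nseq nth_nseq; case: ifP => // lt.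
by rewrite ifT //; apply/eqP; lia.
Qed.

Lemma bpos_next x : bpos (bnext x) = (bpos x).+1 %% size blocks_seq.
Proof.
have := bpos_lt (bnext x); have := bnum_le x.
rewrite /bnext; case: ifP => lt le.
  have -> : bpos (mkside (tag x) (bnum x).+1) = (bpos x).+1.
    by rewrite /bpos bnum_mkside //=; case: (tag x) => e; rewrite !addnS.
  by move=> h; rewrite modn_small.
rewrite {1 2}/bpos bnum_mkside //= /bpos; move: lt le.
case: (tag x) => e /= lt le h.
  by rewrite modn_small; move: h; rewrite (_ : bnum x = plen e) //; lia.
have e1 : (boffset (typ e) + ((plen e).+1 + bnum x)).+1 = boffset (typ e).+1.
  by rewrite boffsetS // size_block_seq -plen_typ -qlen_typ; lia.
move: h; rewrite e1 typ_next addn0; have := typ_lt e; rewrite leq_eqVlt.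
case/orP=> [/eqP ->|lt1]; first by rewrite modnn boffset_size modnn /boffset take0.
by rewrite modn_small // => h; rewrite modn_small.
Qed.

Lemma circle_graph_polygonal (w : F2) (e : E) :
  word_of w = blocks_seq -> cyclically_reduced w -> polygonal w.
Proof.
move=> ew cw.
apply: (@folded_polygonal bside bnext blab _ _ (fun x => bedge (tag x) (bnum x))
  (fun x => bvert (tag x) (bnum x)) borigin bnext_inj bedge_fibre bedge_gen
  bstart_origin bend_origin borigin_inj blab_nocancel (bedge_branching e) w al bpos cw).
- by move=> x; rewrite ew bpos_lt.
- by move=> x; rewrite ew bpos_next.
- by move=> x; rewrite ew blab_pos.
Qed.
End CircleGraph.

(** * Gluing two copies of each block *)

Lemma psum_split (f : nat -> nat) k n : n < \sum_(0 <= r < k) f r ->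
  exists e s, [/\ e < k, s < f e & n = \sum_(0 <= r < e) f r + s].
Proof.
elim: k => [|k IHk]; first by rewrite big_nil.
rewrite big_nat_recr //= => lt; have [h|h] := ltnP n (\sum_(0 <= r < k) f r).
  by have [e [s [ek sf ->]]] := IHk h; exists e, s; split=> //; apply: ltnW.
exists k, (n - \sum_(0 <= r < k) f r); split=> //; last by rewrite subnKC.
by rewrite ltn_subLR.
Qed.

Lemma psum_mono (f : nat -> nat) d e : d <= e ->
  \sum_(0 <= r < d) f r <= \sum_(0 <= r < e) f r.
Proof. by move=> de; rewrite [leqRHS](big_cat_nat (n := d)) //= leq_addr. Qed.

Lemma psum_inj (f : nat -> nat) e e' s s' : s < f e -> s' < f e' ->
  \sum_(0 <= r < e) f r + s = \sum_(0 <= r < e') f r + s' -> e = e' /\ s = s'.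
Proof.
wlog le : e e' s s' / e <= e' => [hw|] hs hs' h.
  have [le|/ltnW le] := leqP e e'; first exact: hw.
  by have [-> ->] := hw _ _ _ _ le hs' hs (esym h).
move: le; rewrite leq_eqVlt => /orP[/eqP ee|lt].
  by subst e'; split=> //; exact: addnI h.
have := psum_mono f lt; rewrite big_nat_recr //=; lia.
Qed.

(** The partial sums of [f] lay the segments one after the other; an index outside [D] has [f e = 0]
    and takes no room on the circle. *)
Lemma sum_winds k (f : nat -> nat) (D : pred 'I_k) (len : 'I_k -> nat) (st : 'I_k -> 'I_k) :
  let L := \sum_(0 <= r < k) f r in let v (e : 'I_k) := \sum_(0 <= r < e) f r in
  (forall e : 'I_k, D e = (0 < f e)) -> (forall e, D e -> len e = f e) ->
  (forall e, D e -> D (st e)) -> (forall e, D e -> v (st e) = v e + f e %[mod L]) ->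
  winds L D len v st.
Proof.
move=> L v hD hlen hst hv.
have vlt e s : D e -> s < len e -> v e + s < L.
  move=> De; rewrite hlen // => hs; apply: leq_trans (psum_mono f (ltn_ord e)).
  by rewrite big_nat_recr //= ltn_add2l.
split=> //.
- move=> e De; rewrite hlen // -hv // modn_small //.
  have Dst := hst e De; rewrite -[v _]addn0; apply: vlt => //.
  by rewrite hlen // -hD.
- move=> n /psum_split[e [s [ek sf ->]]]; exists (Ordinal ek), s.
  have De : D (Ordinal ek) by rewrite hD /=; apply: leq_ltn_trans sf.
  by split=> //; rewrite hlen.
- move=> e e' s s' De De'; rewrite !hlen // => hs hs' /(psum_inj hs hs')[/val_inj -> ->] //.
Qed.

Lemma psum_ordS k (f : nat -> nat) (e : 'I_k) :
  \sum_(0 <= r < ordS e) f r = \sum_(0 <= r < e) f r + f e %[mod \sum_(0 <= r < k) f r].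
Proof.
rewrite -[in RHS]big_nat_recr //=; have := ltn_ord e; rewrite leq_eqVlt.
case/orP => [/eqP ->|lt]; first by rewrite !modnn big_nil mod0n.
by rewrite [X in \sum_(0 <= r < X) _](modn_small lt).
Qed.

Lemma sum_double (F : nat -> nat) l :
  \sum_(0 <= r < l.*2) F r = \sum_(0 <= i < l) (F i.*2 + F i.*2.+1).
Proof.
elim: l => [|l IHl]; first by rewrite !big_nil.
by rewrite doubleS !big_nat_recr //= IHl addnA.
Qed.

Lemma half_mod_double l n : (n %% l.*2)./2 = n./2 %% l.
Proof.
have [->|l0] := posnP l; first by rewrite !modn0.
have e : n = (n %/ l.*2 * l).*2 + n %% l.*2 by rewrite doubleMr -divn_eq.
rewrite [in RHS]e halfD odd_double /= add0n doubleK modnMDl [RHS]modn_small //.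
by rewrite ltn_half_double ltn_mod double_gt0.
Qed.

Lemma odd_mod_double l n : odd (n %% l.*2) = odd n.
Proof. by rewrite {2}(divn_eq n l.*2) oddD oddM odd_double andbF. Qed.

Section BlockWord.
Variables (bs : seq (nat * nat)) (al al' be : letter).
Hypothesis bs_gt0 : 0 < size bs.
Hypothesis bs_pos : all (fun pq => (0 < pq.1) && (0 < pq.2)) bs.
Hypothesis al_gen : al.1 = false.
Hypothesis al'_gen : al'.1 = false.
Hypothesis be_gen : be.1 = true.

Lemma path_block_seq x pq s : x.1 = true -> 0 < pq.1 -> 0 < pq.2 ->
  path nocancel x (block_seq al al' be pq ++ s) = path nocancel be s.
Proof.
have gen_neq (l l' : letter) : l.1 != l'.1 -> nocancel l l'.
  by rewrite /nocancel eq_sym => h; apply: contraNneq h => ->.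
have same (l : letter) : nocancel l l by rewrite /nocancel eq_sym linv_neq.
have pathn (l : letter) n t : path nocancel l (nseq n l ++ t) = path nocancel l t.
  by elim: n => //= n ->; rewrite same.
case: pq => [[//|p] [//|q]] xb _ _; rewrite /block_seq /= -catA /=.
rewrite gen_neq ?xb ?al_gen //= pathn /= gen_neq /= ?al_gen ?be_gen //=.
rewrite gen_neq /= ?al'_gen ?be_gen //= cat_rcons pathn /= gen_neq ?al'_gen ?be_gen //.
Qed.

Lemma cycle_blocks_seq : cycle nocancel (blocks_seq al al' be bs).
Proof.
have last_bs x : last x (blocks_seq al al' be bs) = be.
  rewrite /blocks_seq; case/lastP: bs bs_gt0 => // s pq _.
  by rewrite map_rcons -cats1 flatten_cat /= cats0 !last_cat /= last_rcons.
rewrite (cycle_path be) last_bs /blocks_seq.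
elim: bs bs_pos => //= pq s IHs /andP[/andP[p0 q0] /IHs h].
by rewrite path_block_seq.
Qed.

Let l := size bs.
Let p i := (nth (0, 0) bs i).1.
Let q i := (nth (0, 0) bs i).2.
Variable G : seq nat.
Hypothesis G_uniq : uniq G.
Hypothesis G_sub : forall i, i \in G -> i < l /\ p i = 2.
Hypothesis G_size : \sum_(pq <- bs) pq.1 = \sum_(pq <- bs) pq.2 + size G.

(* Two copies of each block, numbered so that the two copies of block [i] are
   [i.*2] and [i.*2.+1]; the first copy of each block listed in [G] is set aside. *)
Local Notation E := 'I_(l.*2).

Definition aside (n : nat) : bool := ~~ odd n && (n./2 \in G).

(** Only even numbers are set aside, and the wrap at [l.*2] keeps parity alternating, so skipping
    one copy is enough. *)
Definition pstep (e : E) : E :=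
  if aside e then e else if aside (ordS e) then ordS (ordS e) else ordS e.

Let pw r := if aside r then 0 else p r./2.
Let qw r := q r./2.

Lemma p_gt0 i : i < l -> 0 < p i.
Proof. by move=> h; have /(all_nthP (0, 0))/(_ i h)/andP[] := bs_pos. Qed.

Lemma q_gt0 i : i < l -> 0 < q i.
Proof. by move=> h; have /(all_nthP (0, 0))/(_ i h)/andP[] := bs_pos. Qed.

Lemma half_lt (e : E) : e./2 < l.
Proof. by rewrite ltn_half_double. Qed.

Lemma aside_ordS (e : E) : aside e -> ~~ aside (ordS e).
Proof. by case/andP=> oe _; rewrite /aside negb_and negbK /= odd_mod_double /= oe. Qed.

(** The copies set aside remove length 2 for each element of [G]; by [G_size] what is left fits the
    circle of the q-blocks. *)
Lemma sum_pw : \sum_(0 <= r < l.*2) pw r = (\sum_(pq <- bs) pq.2).*2.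
Proof.
suff h : \sum_(0 <= r < l.*2) pw r + (size G).*2 = (\sum_(pq <- bs) pq.1).*2.
  by move: h; rewrite G_size doubleD => /addIn.
have -> : size G = \sum_(0 <= i < l) (i \in G).
  have -> : size G = count (mem G) (iota 0 l).
    rewrite -size_filter; apply/perm_size/uniq_perm; rewrite ?filter_uniq ?iota_uniq //.
    by move=> i; rewrite mem_filter mem_iota add0n /= andb_idr // => /G_sub[].
  rewrite -sum1_count big_mkcond /index_iota subn0; apply: eq_bigr => i _.
  by suff : (if i \in G then 1 else 0) = (i \in G) by []; case: (i \in G).
rewrite (big_nth (0, 0)) sum_double -!muln2 !big_distrl -big_split /=.
apply: eq_big_nat => i /andP[_ lt]; rewrite /pw /aside /= odd_double /= doubleK uphalf_double.
case: ifP => [/G_sub[_ h]|_]; last by rewrite mul0n addn0 muln2 -addnn.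
by rewrite h -/(p i) h.
Qed.

Lemma sum_qw : \sum_(0 <= r < l.*2) qw r = (\sum_(pq <- bs) pq.2).*2.
Proof.
rewrite (big_nth (0, 0)) sum_double -!muln2 !big_distrl /=.
by apply: eq_big_nat => i _; rewrite /qw /= doubleK uphalf_double muln2 addnn.
Qed.

Lemma pstepN (e : E) : ~~ aside e -> ~~ aside (pstep e).
Proof.
rewrite /pstep => /negbTE ->; case: ifP => [/aside_ordS //|/negbT]; exact.
Qed.

Lemma pstep_fix (e : E) : aside e -> pstep e = e.
Proof. by rewrite /pstep => ->. Qed.

Lemma winds_pstep : winds (\sum_(pq <- bs) pq.2).*2 [pred e : E | ~~ aside e]
  (fun e : E => p e./2) (fun e : E => \sum_(0 <= r < e) pw r) pstep.
Proof.
rewrite -sum_pw; apply: sum_winds => e /=.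
- by rewrite /pw; case: ifP => //= _; rewrite p_gt0 ?half_lt.
- by rewrite /pw => /negbTE ->.
- exact: pstepN.
move=> ae; rewrite /pstep (negbTE ae); case: ifP => ho; last exact: psum_ordS.
(* The skipped copy has length 0 in [pw], so the second [ordS] does not move the position. *)
rewrite psum_ordS -modnDml psum_ordS modnDml {3}/pw ho addn0 //.
Qed.

Lemma winds_ordS : winds (\sum_(pq <- bs) pq.2).*2 predT
  (fun e : E => q e./2) (fun e : E => \sum_(0 <= r < e) qw r) (@ordS l.*2).
Proof.
rewrite -sum_qw; apply: sum_winds => e //=; first by rewrite q_gt0 ?half_lt.
by move=> _; exact: psum_ordS.
Qed.

(** The number of the copy grows by 2, except that it grows by 1 when [e + 1] is set aside, which
    forces [e] odd, and by 3 when [e + 2] is set aside, which forces [e] even. In all cases the half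
    grows by 1, so each polygon reads the blocks in their cyclic order. *)
Lemma pstep_type (e : E) : (pstep (ordS e))./2 = (e./2).+1 %% l.
Proof.
have val2 (x : E) : ordS (ordS x) = x.+2 %% l.*2 :> nat by rewrite /= -addn1 modnDml addn1.
have val3 (x : E) : ordS (ordS (ordS x)) = x.+3 %% l.*2 :> nat.
  by rewrite val2 /= -addn2 modnDml addn2.
rewrite /pstep /aside val2 !odd_mod_double /= negbK; case: ifP => [/andP[oe _]|_].
  by rewrite half_mod_double /= uphalf_half oe.
case: ifP => [/andP[/negbTE oe _]|_]; last by rewrite val2 half_mod_double.
by rewrite val3 half_mod_double /= uphalf_half oe.
Qed.

Theorem blocks_polygonal (w : F2) :
  word_of w = blocks_seq al al' be bs -> polygonal w.
Proof.
move=> ew.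
have l20 : 0 < l.*2 by rewrite double_gt0.
apply: (circle_graph_polygonal (D := [pred e : E | ~~ aside e]) (plen := fun e : E => p e./2)
  (qlen := fun e : E => q e./2) (P := pstep) (Q := @ordS l.*2) _ _ winds_pstep winds_ordS
  _ _ al_gen al'_gen be_gen (typ := fun e : E => e./2) _ pstep_type _ _ (Ordinal l20) ew) => //=.
- by move=> e; rewrite p_gt0 ?half_lt.
- by move=> e; rewrite q_gt0 ?half_lt.
- by move=> e; rewrite negbK => /andP[_ /G_sub[]].
- by move=> e; rewrite negbK; exact: pstep_fix.
- exact: half_lt.
- by rewrite /cyclically_reduced ew cycle_blocks_seq.
Qed.
End BlockWord.

(** * Runs of positive words *)

Fixpoint occ (c : bool) (s : seq bool) : nat :=
  if s is _ :: s' then prefix [:: ~~ c; c; c; ~~ c] s + occ c s' else 0.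

Lemma occ_cat_ge c s t : occ c s + occ c t <= occ c (s ++ t).
Proof.
elim: s => // x s IHs; rewrite cat_cons /= -addnA leq_add //.
have cp (p u v : seq bool) : prefix p u <= prefix p (u ++ v).
  by case: (boolP (prefix p u)) => // /prefixP[w ->]; rewrite -catA prefix_prefix.
exact: (cp [:: ~~ c; c; c; ~~ c] (x :: s) t).
Qed.

(** An occurrence that straddles the cut starts among the last three letters of [s]. *)
Lemma occ_cat_le c s t : occ c (s ++ t) <= occ c s + occ c t + minn 3 (size s).
Proof.
elim: s => [|x s IHs]; first by rewrite addn0.
have [h|h] := leqP 3 (size s).
  have -> : occ c ((x :: s) ++ t) = prefix [:: ~~ c; c; c; ~~ c] (x :: s) + occ c (s ++ t).
    by case: s h {IHs} => [|y [|z [|a s]]] //= _; rewrite !prefix0s.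
  have -> : occ c (x :: s) = prefix [:: ~~ c; c; c; ~~ c] (x :: s) + occ c s by [].
  by move: IHs; rewrite /= !(minn_idPl _) //; lia.
have -> : occ c ((x :: s) ++ t) = prefix [:: ~~ c; c; c; ~~ c] (x :: s ++ t) + occ c (s ++ t) by [].
have -> : occ c (x :: s) = prefix [:: ~~ c; c; c; ~~ c] (x :: s) + occ c s by [].
move: IHs; rewrite /= !(minn_idPr _) //; [|lia..].
have := leq_b1 (prefix [:: ~~ c; c; c; ~~ c] (x :: s ++ t)); rewrite /=; lia.
Qed.

Lemma occ_split c s : 0 < occ c s -> exists u v, s = u ++ [:: ~~ c, c & v].
Proof.
elim: s => // x s IHs.
have -> : occ c (x :: s) = prefix [:: ~~ c; c; c; ~~ c] (x :: s) + occ c s by [].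
case: (boolP (prefix _ _)) => [/prefixP[v ->] _|_]; first by exists [::], [:: c, ~~ c & v].
by rewrite add0n => /IHs[u [v ->]]; exists (x :: u), v.
Qed.

Definition unblock (c : bool) (bs : seq (nat * nat)) : seq bool :=
  flatten [seq nseq pq.1 c ++ nseq pq.2 (~~ c) | pq <- bs].

(** The term with [prefix] makes the induction work: an initial run of exactly two letters [c] is a
    block with p = 2, but [occ] sees it only once a letter [~~ c] is put in front. *)
Lemma unblockP c s : (s == [::]) || (last c s == ~~ c) ->
  exists q0 bs, [/\ s = nseq q0 (~~ c) ++ unblock c bs,
    all (fun pq => (0 < pq.1) && (0 < pq.2)) bs
  & occ c s + prefix [:: c; c; ~~ c] s <= count (fun pq => pq.1 == 2) bs].
Proof.
elim: s => [|x s IHs] h; first by exists 0, [::].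
have hs : (s == [::]) || (last c s == ~~ c) by case: s h {IHs} => //= y s ->; rewrite orbT.
have [q0 [bs [es ps os]]] := IHs hs.
have [xc|xc] := eqVneq x c; last first.
  have {}xc : x = ~~ c by case: x c xc {h IHs hs es os} => [] [].
  exists q0.+1, bs; split=> //; first by rewrite es xc.
  by rewrite xc /= eqxx; move: os; case: c {h IHs hs es xc}; rewrite /= addn0 addnC.
have ccN : (c == ~~ c) = false by case: (c).
have -> : occ c (x :: s) = occ c s by rewrite xc /= eq_sym ccN.
rewrite {}xc in h *; case: q0 es => [|q0] es.
  case: bs es ps os => [|[p q] bs] es ps os; first by move: h; rewrite es /= ccN.
  exists 0, ((p.+1, q) :: bs); split; first by rewrite es.
    by move: ps => /= /andP[/andP[_ ->] ->].
  move: ps os; rewrite /= => /andP[/andP[p0 q0] _].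
  have -> : prefix [:: c; c; ~~ c] s = (p == 2).
    by rewrite es /=; case: p q p0 q0 {es} => [|[|[|p]]] [|q] //= _ _;
      case: (c); rewrite //= ?prefix0s ?eqxx.
  have -> : prefix [:: c; ~~ c] s = (p == 1).
    by rewrite es /=; case: p q p0 q0 {es} => [|[|p]] [|q] //= _ _;
      case: (c); rewrite //= ?prefix0s ?eqxx.
  by rewrite eqxx /= eqSS; lia.
exists 0, ((1, q0.+1) :: bs); split; [by rewrite es|exact: ps|].
have h1 : prefix [:: c; c; ~~ c] s = false by rewrite es /= ccN.
have h2 : prefix [:: c; ~~ c] s = false by rewrite es /= ccN.
by move: os; rewrite [prefix _ (c :: s)]/= eqxx h1 h2.
Qed.

Lemma count_unblock c bs :
  count (pred1 c) (unblock c bs) = \sum_(pq <- bs) pq.1 /\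
  count (pred1 (~~ c)) (unblock c bs) = \sum_(pq <- bs) pq.2.
Proof.
have ccN : (c == ~~ c) = false by case: (c).
elim: bs => [|pq bs [IH1 IH2]]; first by rewrite !big_nil.
rewrite !big_cons -{}IH1 -{}IH2 /unblock /= !count_cat !count_nseq /= !eqxx ccN.
by rewrite eq_sym ccN !mul1n !mul0n addn0 add0n.
Qed.

(** * From positive words to block words in the free group *)

Definition F2_gen (c : bool) : F2 := if c then F2b else F2a.

Lemma word_of_prod (s : seq letter) :
  word_of (\prod_(x <- s) F2_letter x)%g = foldr push [::] s.
Proof. by elim: s => [|x s IHs]; rewrite ?big_nil // big_cons /= IHs. Qed.

Lemma prod_nseq (T : Type) (F : T -> F2) n x :
  (\prod_(y <- nseq n x) F y)%g = (F x ^+ n)%g.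
Proof. by elim: n => [|n IHn]; rewrite ?big_nil //= big_cons IHn expgS. Qed.

Lemma prod_blocks_seq al al' be bs :
  (\prod_(x <- blocks_seq al al' be bs) F2_letter x =
   \prod_(pq <- bs) (F2_letter al ^+ pq.1 * (F2_letter be)^-1 *
     F2_letter al' ^+ pq.2 * F2_letter be))%g.
Proof.
rewrite /blocks_seq big_flatten big_map; apply: eq_bigr => pq _.
rewrite /block_seq big_cat big_cons -cats1 big_cat big_seq1 !prod_nseq /=.
have -> : F2_letter (linv be) = (F2_letter be)^-1%g by apply: val_inj.
by rewrite !mulgA.
Qed.

Lemma conjugate_polygonal_conj g h :
  conjugate_polygonal (g ^ h)%g -> conjugate_polygonal g.
Proof.
move=> [w [[k ->] cw pw]]; exists ((g ^ h) ^ k)%g; split=> //.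
by exists (h * k)%g; rewrite conjgM.
Qed.

Section Endomorphism.
Variables (eps delta : int).
Hypothesis heps : eps = 1%R \/ eps = (-1)%R.
Hypothesis hdelta : delta = 1%R \/ delta = (-1)%R.
Variable f : {multiplicative F2 -> F2}.
Hypothesis fa : f F2a = zexpg F2a eps.
Hypothesis fb : f F2b = (F2b^-1 * zexpg F2a delta * F2b)%g.

Lemma zexpg_F2a (z : int) : z = 1%R \/ z = (-1)%R ->
  zexpg F2a z = F2_letter (false, z == (-1)%R).
Proof. by case=> ->; apply: val_inj. Qed.

Definition F2_positive (s : seq bool) : F2 := (\prod_(c <- s) F2_gen c)%g.

Lemma endo1 : f 1%g = 1%g.
Proof. by apply: (mulgI (f 1%g)); rewrite -gmulfM !mulg1. Qed.

Lemma endoX n x : f (x ^+ n)%g = (f x ^+ n)%g.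
Proof. by elim: n => [|n IHn]; rewrite ?endo1 // !expgS gmulfM IHn. Qed.

Lemma F2_positive_rot u v :
  conjugate_polygonal (f (F2_positive (v ++ u))) ->
  conjugate_polygonal (f (F2_positive (u ++ v))).
Proof.
rewrite /F2_positive !big_cat /= !gmulfM; set x := f _; set y := f _.
have -> : (x * y = (y * x) ^ y)%g by rewrite conjgE !mulgA mulVg mul1g.
exact: conjugate_polygonal_conj.
Qed.

(** For [c = false] the image under [f] is the block word itself. For [c = true] the runs of b are
    the p-blocks: conjugation by [b^-1] turns [b^-1 A b A'] into [A b A' b^-1], so [eps] and [delta]
    exchange roles and [be] is the inverse of b. *)
Lemma unblock_polygonal c bs : 0 < size bs ->
  all (fun pq => (0 < pq.1) && (0 < pq.2)) bs ->
  \sum_(pq <- bs) pq.2 <= \sum_(pq <- bs) pq.1 ->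
  \sum_(pq <- bs) pq.1 <= \sum_(pq <- bs) pq.2 + count (fun pq => pq.1 == 2) bs ->
  conjugate_polygonal (f (F2_positive (unblock c bs))).
Proof.
move=> bs0 ps le1 le2.
pose al : letter := (false, (if c then delta else eps) == (-1)%R).
pose al' : letter := (false, (if c then eps else delta) == (-1)%R).
pose be : letter := (true, c).
have cyc : cycle nocancel (blocks_seq al al' be bs) by exact: cycle_blocks_seq.
have red : reduced (blocks_seq al al' be bs).
  by case: (blocks_seq _ _ _ _) cyc => //= x s; rewrite rcons_path => /andP[].
exists (MkF2 red); split=> //.
  exists (if c then F2_letter be else 1%g).
  have -> : MkF2 red = (\prod_(x <- blocks_seq al al' be bs) F2_letter x)%g.
    by apply: val_inj; rewrite /= word_of_prod foldr_push_nil.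
  rewrite prod_blocks_seq /F2_positive /unblock big_flatten big_map.
  rewrite (big_morph f gmulfM endo1) conjg_prod.
  apply: eq_bigr => -[p q] _ /=; rewrite big_cat /= !prod_nseq gmulfM !endoX.
  rewrite conjMg !conjXg /al /al' /be; move: fa fb; rewrite !zexpg_F2a //.
  move=> fa' fb'; case: (c) => /=; rewrite /F2_gen fa' fb'.
    have -> : F2_letter (true, true) = F2b^-1%g by apply: val_inj.
    have -> x : (F2b^-1 * x * F2b)%g = (x ^ F2b)%g by rewrite conjgE mulgA.
    by rewrite -conjgM mulgV conjg1 -conjXg conjgE invgK !mulgA.
  rewrite -/F2b !conjg1; have -> x : (F2b^-1 * x * F2b)%g = (x ^ F2b)%g by rewrite conjgE mulgA.
  by rewrite -conjXg conjgE !mulgA.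
(* The excess [D] is removed by setting aside the first [D] blocks with p = 2; the second inequality
   says that there are enough of them. *)
pose D := \sum_(pq <- bs) pq.1 - \sum_(pq <- bs) pq.2.
pose twos := [seq i <- iota 0 (size bs) | (nth (0, 0) bs i).1 == 2].
have szt : size twos = count (fun pq => pq.1 == 2) bs.
  rewrite size_filter -[in RHS](mkseq_nth (0, 0) bs) /mkseq count_map.
  by apply: eq_count.
apply: (@blocks_polygonal bs al al' be bs0 ps _ _ _ (take D twos)) => //.
- by rewrite take_uniq // filter_uniq // iota_uniq.
- by move=> i /mem_take; rewrite mem_filter mem_iota add0n => /andP[/eqP].
- by rewrite size_takel ?subnKC // szt leq_subLR.
Qed.

(** The word is rotated so that it starts with [c] and ends with [~~ c]. The cut loses at most three
    occurrences counted by [occ], which is the margin 3 in the hypothesis. *)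
Lemma majority_polygonal c s : count (pred1 (~~ c)) s <= count (pred1 c) s ->
  count (pred1 c) s + 3 <= count (pred1 (~~ c)) s + occ c s ->
  conjugate_polygonal (f (F2_positive s)).
Proof.
move=> le1 le2.
have /occ_split[u [v es]] : 0 < occ c s by lia.
pose u' := rcons u (~~ c); pose v' := c :: v.
have {}es : s = u' ++ v' by rewrite cat_rcons.
rewrite es; apply: F2_positive_rot.
have lst : (v' ++ u' == [::]) || (last c (v' ++ u') == ~~ c).
  by rewrite last_cat last_rcons eqxx orbT.
have [q0 [bs [ebs pbs obs]]] := unblockP lst.
(* The rotated word starts with [c], so there is no initial run of [~~ c]. *)
case: q0 ebs => [|q0] ebs; last by move: ebs => /= [] /eqP; case: (c).
have cE a : count (pred1 a) s = count (pred1 a) (v' ++ u').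
  by rewrite es !count_cat addnC.
move: le1 le2; rewrite !{}cE => le1 le2; move: le1 le2.
have oE : occ c s <= occ c (v' ++ u') + 3.
  rewrite es; apply: leq_trans (occ_cat_le c u' v') _.
  have := occ_cat_ge c v' u'; have := geq_minl 3 (size u'); lia.
rewrite ebs cat0s in obs oE *; have [-> ->] := count_unblock c bs => le1 le2.
apply: unblock_polygonal => //; last by lia.
by case: bs ebs {pbs obs oE le1 le2} => //.
Qed.
End Endomorphism.

Import Order.TTheory GRing.Theory Num.Theory.
Local Open Scope classical_set_scope.
Local Open Scope ring_scope.

(** * The probability estimate *)

Lemma sum_tupleS (R : nmodType) (T : finType) n (F : seq T -> R) :
  \sum_(t : n.+1.-tuple T) F t = \sum_(x : T) \sum_(t : n.-tuple T) F (x :: t).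
Proof.
rewrite pair_big /=.
rewrite (reindex (fun p : T * n.-tuple T => cons_tuple p.1 p.2)) //=.
exists (fun t => (thead t, behead_tuple t)) => [[x t] _|t _] /=.
  by congr pair; apply: val_inj.
by rewrite [RHS](tuple_eta t); apply: val_inj.
Qed.

Section Chernoff.
Variables (R : realType) (c : bool).

(* Any constant slightly above 1 would do: in a window of four letters, the
   number of letters [c] minus the number of letters [~~ c], minus 1 if the
   window is [:: ~~ c; c; c; ~~ c], has mean -1/16. *)
Definition tilt : R := 51%:R / 50%:R.

Lemma tilt_ge1 : 1 <= tilt.
Proof. by rewrite /tilt; lra. Qed.

Lemma tilt_gt0 : 0 < tilt.
Proof. exact: lt_le_trans ltr01 tilt_ge1. Qed.

Definition letter_tilt (x : bool) : R := if x == c then tilt else tilt^-1.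

Definition window_tilt (x1 x2 x3 x4 : bool) : R :=
  letter_tilt x1 * letter_tilt x2 * letter_tilt x3 * letter_tilt x4 /
  (if [:: x1; x2; x3; x4] == [:: ~~ c; c; c; ~~ c] then tilt else 1).

(** Cutting into disjoint windows makes the sum over all words factor; the at most three letters
    left over are bounded by [tilt ^+ 3]. *)
Fixpoint word_tilt (s : seq bool) : R :=
  if s is x1 :: x2 :: x3 :: x4 :: s' then window_tilt x1 x2 x3 x4 * word_tilt s'
  else tilt ^+ 3.

Lemma seq4_ind (P : seq bool -> Prop) :
  (forall s, (size s < 4)%N -> P s) ->
  (forall x1 x2 x3 x4 s, P s -> P [:: x1, x2, x3, x4 & s]) -> forall s, P s.
Proof.
move=> P0 P4 s; move: {2}(size s) (leqnn (size s)) => n; elim: n s => [|n IHn] s.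
  by rewrite leqn0 => /eqP e; apply: P0; rewrite e.
case: s => [|x1 [|x2 [|x3 [|x4 s]]]] h; try exact: P0.
by apply/P4/IHn; move: h => /=; lia.
Qed.

Lemma window_tilt_gt0 x1 x2 x3 x4 : 0 < window_tilt x1 x2 x3 x4.
Proof.
have lt x : 0 < letter_tilt x by rewrite /letter_tilt; case: ifP; rewrite ?invr_gt0 tilt_gt0.
by rewrite divr_gt0 ?mulr_gt0 ?lt //; case: ifP => // _; exact: tilt_gt0.
Qed.

Lemma word_tilt_ge0 s : 0 <= word_tilt s.
Proof.
elim/seq4_ind: s => [|x1 x2 x3 x4 s IHs] /=; last by rewrite mulr_ge0 // ltW ?window_tilt_gt0.
by move=> [|x1 [|x2 [|x3 [|x4 s]]]] //= _; rewrite exprn_ge0 // ltW // tilt_gt0.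
Qed.

(** The weight dominates [tilt] to the power #c - #(~~ c) - occ, written here without negative
    exponents: disjoint windows can only miss occurrences. *)
Lemma word_tilt_ge s : tilt ^+ count (pred1 c) s <=
  word_tilt s * tilt ^+ (count (pred1 (~~ c)) s + occ c s).
Proof.
elim/seq4_ind: s => [s hs|x1 x2 x3 x4 s IHs].
  have -> : word_tilt s = tilt ^+ 3 by case: s hs => [|x1 [|x2 [|x3 [|x4 s]]]].
  apply: (@le_trans _ _ (tilt ^+ 3)).
    by rewrite ler_weXn2l ?tilt_ge1 //; apply: leq_trans (count_size _ _) _; rewrite -ltnS.
  by rewrite ler_peMr ?exprn_ge0 ?exprn_ege1 ?tilt_ge1 // ltW // tilt_gt0.
have oc : (([:: x1; x2; x3; x4] == [:: ~~ c; c; c; ~~ c]) + occ c s <=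
    occ c [:: x1, x2, x3, x4 & s])%N.
  apply: leq_trans (occ_cat_ge c [:: x1; x2; x3; x4] s); rewrite leq_add2r.
  by case: eqP => // -> /=; rewrite !eqxx.
apply: (@le_trans _ _ (word_tilt [:: x1, x2, x3, x4 & s] *
    tilt ^+ (count (pred1 (~~ c)) [:: x1, x2, x3, x4 & s] +
      (([:: x1; x2; x3; x4] == [:: ~~ c; c; c; ~~ c]) + occ c s)))); last first.
  rewrite ler_wpM2l ?word_tilt_ge0 // ler_weXn2l ?tilt_ge1 // leq_add2l //.
have cE a : count (pred1 a) [:: x1, x2, x3, x4 & s] =
  ((x1 == a) + (x2 == a) + (x3 == a) + (x4 == a) + count (pred1 a) s)%N by rewrite /= !addnA.
rewrite !cE /= /window_tilt.
have tn0 : tilt != 0 by rewrite gt_eqF ?tilt_gt0.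
have lt x : tilt ^+ (x == c) = letter_tilt x * tilt ^+ (x == ~~ c).
  by rewrite /letter_tilt; case: x (c) => [] [] /=; rewrite ?mulVf // mulr1.
set b := _ == [:: ~~ c; c; c; ~~ c].
have bE : (if b then tilt else 1) = tilt ^+ b :> R by case: b.
rewrite bE !exprD !lt.
have bn0 : tilt ^+ b != 0 :> R by rewrite expf_neq0.
move: IHs; rewrite exprD; set A := tilt ^+ count (pred1 c) s => IHs.
set k := letter_tilt x1 * letter_tilt x2 * letter_tilt x3 * letter_tilt x4 *
  (tilt ^+ (x1 == ~~ c) * tilt ^+ (x2 == ~~ c) * tilt ^+ (x3 == ~~ c) * tilt ^+ (x4 == ~~ c)).
have k0 : 0 <= k.
  have lg x : 0 <= letter_tilt x.
    by rewrite /letter_tilt; case: ifP; rewrite ?invr_ge0 ltW // tilt_gt0.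
  by rewrite /k !mulr_ge0 ?lg ?exprn_ge0 // ltW // tilt_gt0.
have := ler_wpM2l k0 IHs.
congr (_ <= _); rewrite /k; [by ring|].
by field.
Qed.

Definition window_sum : R :=
  \sum_(x1 : bool) \sum_(x2 : bool) \sum_(x3 : bool) \sum_(x4 : bool) window_tilt x1 x2 x3 x4.

Lemma window_sum_ge0 : 0 <= window_sum.
Proof. by do 4 (apply: sumr_ge0 => ? _); rewrite ltW // window_tilt_gt0. Qed.

Lemma window_sum_lt16 : window_sum < 16.
Proof.
rewrite /window_sum !big_bool /window_tilt /letter_tilt /tilt.
case: (c) => /=; lra.
Qed.

Lemma sum_word_tilt m j : (j < 4)%N ->
  \sum_(t : (4 * m + j).-tuple bool) word_tilt t = window_sum ^+ m * (2 ^+ j * tilt ^+ 3).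
Proof.
move=> j4; elim: m => [|m IHm].
  rewrite expr0 mul1r muln0 add0n.
  rewrite (eq_bigr (fun=> tilt ^+ 3)); last first.
    move=> t _; have := size_tuple t; case: (tval t) => [|x1 [|x2 [|x3 [|x4 s]]]] //= h.
    by rewrite -h in j4.
  by rewrite sumr_const card_tuple card_bool -[LHS]mulr_natl natrX.
have -> : (4 * m.+1 + j = (4 * m + j).+4)%N by lia.
rewrite sum_tupleS exprS -mulrA -{}IHm /window_sum mulr_suml.
apply: eq_bigr => x1 _; rewrite (sum_tupleS _ (fun s => word_tilt (x1 :: s))) mulr_suml.
apply: eq_bigr => x2 _; rewrite (sum_tupleS _ (fun s => word_tilt (x1 :: x2 :: s))) mulr_suml.
apply: eq_bigr => x3 _; rewrite (sum_tupleS _ (fun s => word_tilt [:: x1, x2, x3 & s])) mulr_suml.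
by apply: eq_bigr => x4 _ /=; rewrite mulr_sumr.
Qed.

Definition few_twos (s : seq bool) : bool :=
  (count (pred1 (~~ c)) s + occ c s < count (pred1 c) s + 3)%N.

(** Markov's inequality: on [few_twos] the exponent #c - #(~~ c) - occ is at least -2, so the weight
    times [tilt ^+ 2] is at least 1. The remaining [tilt ^+ 3] of the constant comes from the
    letters outside the windows. *)
Lemma card_few_twos N :
  #|[set t : N.-tuple bool | few_twos t]%SET|%:R / 2 ^+ N <=
  tilt ^+ 5 * (window_sum / 16) ^+ (N %/ 4) :> R.
Proof.
rewrite ler_pdivrMr ?exprn_gt0 //.
apply: (@le_trans _ _ (\sum_(t : N.-tuple bool) (word_tilt t * tilt ^+ 2))).
  rewrite -sum1_card natr_sum big_mkcond /=; apply: ler_sum => t _; rewrite inE.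
  case: ifP => [h|_]; last by rewrite mulr_ge0 ?word_tilt_ge0 // exprn_ge0 // ltW // tilt_gt0.
  rewrite -(@ler_pM2r _ (tilt ^+ (count (pred1 (~~ c)) t + occ c t))) ?exprn_gt0 ?tilt_gt0 //.
  rewrite mul1r mulrAC; apply: (@le_trans _ _ (tilt ^+ count (pred1 c) t * tilt ^+ 2)).
    by rewrite -exprD ler_weXn2l ?tilt_ge1 //; move: h; rewrite /few_twos; lia.
  by rewrite ler_wpM2r ?word_tilt_ge // exprn_ge0 // ltW // tilt_gt0.
rewrite -mulr_suml.
have [m [j [j4 ->]]] : exists m j, (j < 4)%N /\ N = (4 * m + j)%N.
  by exists (N %/ 4)%N, (N %% 4)%N; split; [rewrite ltn_mod|rewrite mulnC -divn_eq].
rewrite sum_word_tilt // (_ : ((4 * m + j) %/ 4 = m)%N); last first.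
  by rewrite mulnC divnMDl // divn_small // addn0.
have -> : window_sum ^+ m = (window_sum / 16) ^+ m * 2 ^+ (4 * m) :> R.
  by rewrite exprM -exprMn -[2 ^+ 4]natrX divfK.
by rewrite exprD le_eqVlt; apply/orP; left; apply/eqP; ring.
Qed.
End Chernoff.

Lemma divn_cvgny d : (0 < d)%N -> (fun n => (n %/ d)%N) @ \oo --> \oo.
Proof.
move=> d0; apply/cvgnyPge => A; near=> n; rewrite leq_divRL //.
by near: n; exact: nbhs_infty_ge.
Unshelve. all: by end_near. Qed.

Lemma few_twos_cvg0 (R : realType) c :
  (fun N => tilt R ^+ 5 * (window_sum R c / 16) ^+ (N %/ 4)) @ \oo --> (0 : R).
Proof.
rewrite -[0](mulr0 (tilt R ^+ 5)); apply: cvgMr.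
apply: (cvg_comp (fun n => (n %/ 4)%N) (fun m => (window_sum R c / 16) ^+ m)).
  exact: divn_cvgny.
apply: cvg_expr; rewrite ger0_norm ?divr_ge0 ?window_sum_ge0 //.
by rewrite ltr_pdivrMr // mul1r window_sum_lt16.
Qed.

Theorem mainTheorem5 (R : realType) (eps delta : int)
  (heps : eps = 1 \/ eps = -1) (hdelta : delta = 1 \/ delta = -1)
  (f : {multiplicative F2 -> F2})
  (fa : f F2a = zexpg F2a eps)
  (fb : f F2b = (F2b^-1 * zexpg F2a delta * F2b)%g) :
  (fun N : nat => prob_positive R N (fun x => conjugate_polygonal (f x)))
    @ \oo --> (1 : R).
Proof.
pose err c N : R := tilt R ^+ 5 * (window_sum R c / 16) ^+ (N %/ 4).
have err0 : (fun N => 1 - (err true N + err false N)) @ \oo --> (1 : R).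
  rewrite -[X in _ --> X]subr0 -[X in _ - X]addr0.
  by apply: cvgB; [exact: cvg_cst|apply: cvgD; exact: few_twos_cvg0].
have cst1 : (fun=> 1 : R) @ \oo --> (1 : R) by exact: cvg_cst.
apply: squeeze_cvgr err0 cst1; near=> N.
rewrite /prob_positive; set A := finset _.
have cardT : #|{: N.-tuple bool}|%:R = 2 ^+ N :> R by rewrite card_tuple card_bool natrX.
apply/andP; split; last first.
  by rewrite ler_pdivrMr ?exprn_gt0 // mul1r -cardT ler_nat max_card.
rewrite lerBlDr.
apply: (@le_trans _ _ (#|A|%:R / 2 ^+ N +
  (#|[set t : N.-tuple bool | few_twos true t]%SET|%:R / 2 ^+ N
   + #|[set t : N.-tuple bool | few_twos false t]%SET|%:R / 2 ^+ N))); last first.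
  by rewrite lerD2l lerD // card_few_twos.
rewrite -!mulrDl ler_pdivlMr ?exprn_gt0 // mul1r -cardT -!natrD ler_nat -cardsT.
(* Union bound: a word outside both exceptional sets belongs to [A]. *)
apply: (@leq_trans #|A :|: ([set t : N.-tuple bool | few_twos true t]
   :|: [set t : N.-tuple bool | few_twos false t])%SET|); last first.
  apply: leq_trans (leq_card_setU _ _) _; rewrite leq_add2l; exact: leq_card_setU.
apply/subset_leq_card/fintype.subsetP => t _; rewrite !inE.
have [_|nt] := boolP (few_twos true t); first by rewrite orbT.
have [_|nf] := boolP (few_twos false t); first by rewrite !orbT.
rewrite !orbF /=; apply/asboolP; move: nt nf; rewrite /few_twos -!leqNgt /= => nt nf.
(* The more frequent letter takes the role of [c]. *)
have [h|/ltnW h] := leqP (count (pred1 true) t) (count (pred1 false) t).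
  exact: (majority_polygonal (c := false) heps hdelta fa fb).
exact: (majority_polygonal (c := true) heps hdelta fa fb).
Unshelve. all: by end_near. Qed.
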